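(* Let $m,n\in\mathbb N$, $r=\min\{m,n\}$, let $f_1:\mathbb R^{m\times n}\to\mathbb R$, $f_2^{\mathcal V}:\mathbb R^r\to\mathbb R$, $h^{\mathcal V}:\mathbb R^r\to(-\infty,\infty]$ and $M_2\in\mathbb R$ satisfy the assumptions listed in the context, let $f_2=f_2^{\mathcal V}\circ\sigma$ and $h=h^{\mathcal V}\circ\sigma$, and let $\lambda>0$, $\theta>0$, $Z_0\in\mathbb R^{m\times n}$. Put $M_2^+=\max\{M_2,0\}$ and $$\mu=1,\quad M=\lambda M_2^++1,\quad \psi_s(U)=\lambda\left[f_1(Z_0)+\langle\nabla f_1(Z_0),U-Z_0\rangle+f_2(U)\right]+\tfrac12\|U-Z_0\|_F^2,\quad\psi_n=\lambda h .$$ The spectral R-ACG algorithm (defined in the context) has the following properties: (a) if it stops with success, then its output triple $(Y,V,\varepsilon)$ solves Problem $\mathcal B$ (defined in the context) on $\mathbb R^{m\times n}$ with data $(\mu,M,\psi_s,\psi_n)$, $\theta$ and $Z_0$; (b) if $f_2$ is convex, then it always stops with success and its output $(Y,V,\varepsilon)$ solves Problem $\mathcal A$ (defined in the context) on $\mathbb R^{m\times n}$ with data $(\mu,\psi_s,\psi_n)$, $\theta$ and $Z_0$.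
   Context: Notation. $\sigma(U)\in\mathbb R^r$ is the vector of singular values of $U\in\mathbb R^{m\times n}$ in nonincreasing order. $\operatorname{dg}z$ is the (rectangular, $m\times n$) diagonal matrix with diagonal $z\in\mathbb R^r$, and $\operatorname{Dg}Z\in\mathbb R^r$ is the diagonal of $Z$. $\overline{\mathrm{Conv}}\,\mathcal Z$ is the set of proper lower semicontinuous convex functions on $\mathcal Z$; $\ell_g(u;y):=g(y)+\langle\nabla g(y),u-y\rangle$; for $\varepsilon\ge0$, $\partial_\varepsilon g(y)=\{w:g(u)\ge g(y)+\langle w,u-y\rangle-\varepsilon\ \forall u\}$ ($g$ not necessarily convex). Assumptions. $f_2^{\mathcal V}$ and $h^{\mathcal V}$ are absolutely symmetric (invariant under permutations and sign changes of the entries of their argument); $h^{\mathcal V}\in\overline{\mathrm{Conv}}\,\mathbb R^r$; $f_1$ and $f_2^{\mathcal V}$ are continuously differentiable; for some $m_1,M_1,m_2$ (and the given $M_2$), $-\frac{m_1}2\|U-Y\|_F^2\le f_1(U)-\ell_{f_1}(U;Y)\le\frac{M_1}2\|U-Y\|_F^2$ on $\operatorname{dom}h$ and $-\frac{m_2}2\|u-y\|^2\le f_2^{\mathcal V}(u)-\ell_{f_2^{\mathcal V}}(u;y)\le\frac{M_2}2\|u-y\|^2$ on $\operatorname{dom}h^{\mathcal V}$; the gradients of $f_1$, $f_2^{\mathcal V}$ are Lipschitz on $\operatorname{dom}h$, $\operatorname{dom}h^{\mathcal V}$ with constants $\max\{|m_1|,|M_1|\}$, $\max\{|m_2|,|M_2|\}$.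 As required for R-ACG inputs, $f_2^{\mathcal V}(u)-\ell_{f_2^{\mathcal V}}(u;y)\le\frac{M_2^+}2\|u-y\|^2$ for all $u,y\in\mathbb R^r$, and $\lambda M_2^+>0$. Problems. Let $\mathcal Z$ be a finite dimensional inner product space, $\psi=\psi_s+\psi_n$, $\mu,\theta>0$, $z_0\in\mathcal Z$. Problem $\mathcal A$: find $(y,v,\varepsilon)\in\operatorname{dom}\psi\times\mathcal Z\times\mathbb R_+$ with $v\in\partial_\varepsilon(\psi-\frac\mu2\|\cdot-y\|^2)(y)$ and $\|v\|^2+2\varepsilon\le\theta^2\|y-z_0\|^2$. Problem $\mathcal B$: find $(y,v,\varepsilon)\in\operatorname{dom}\psi\times\mathcal Z\times\mathbb R_+$ with $\|v\|^2+2\varepsilon\le\theta^2\|y-z_0\|^2$ and $\Delta_\mu(y_r;y,v)\le\varepsilon$, where $\Delta_\mu(u;y,v):=\psi(y)-\psi(u)-\langle v,y-u\rangle+\frac\mu2\|u-y\|^2$ and $(y_r,v_r)=RP(y,v)$ is given by $y_r=\operatorname{argmin}_{u}\{\langle\nabla\psi_s(y)-v,u\rangle+\frac M2\|u-y\|^2+\psi_n(u)\}$, $v_r=v+M(y-y_r)+\nabla\psi_s(y_r)-\nabla\psi_s(y)$. On $\mathbb R^{m\times n}$ the trace inner product and Frobenius norm are used. R-ACG algorithm (on $\mathcal Z$). Input: $(\mu,M,\psi_s,\psi_n)$ with $M>\mu>0$, $\psi_n\in\overline{\mathrm{Conv}}\,\mathcal Z$, $\psi_s$ continuously differentiable with $\psi_s(u)-\ell_{\psi_s}(u;y)\le\frac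 M2\|u-y\|^2$ for all $u,y\in\mathcal Z$; and $(\theta,z_0)\in(0,\infty)\times\mathcal Z$. Step 0: $\psi=\psi_s+\psi_n$, $z_0^c=z_0$, $B_0=0$, $\Gamma_0\equiv0$, $j=1$. Step 1: $\xi_{j-1}=\frac{1+\mu B_{j-1}}{M-\mu}$, $b_{j-1}=\frac{\xi_{j-1}+\sqrt{\xi_{j-1}^2+4\xi_{j-1}B_{j-1}}}2$, $B_j=B_{j-1}+b_{j-1}$, $\tilde z_{j-1}=\frac{B_{j-1}}{B_j}z_{j-1}+\frac{b_{j-1}}{B_j}z^c_{j-1}$, $z_j=\operatorname{argmin}_u\{\ell_{\psi_s}(u;\tilde z_{j-1})+\psi_n(u)+\frac M2\|u-\tilde z_{j-1}\|^2\}$, $z_j^c=\frac1{1+\mu B_j}[z^c_{j-1}-b_{j-1}(M-\mu)(\tilde z_{j-1}-z_j)+\mu(B_{j-1}z^c_{j-1}+b_{j-1}z_j)]$. Step 2: $\tilde\gamma_j=\ell_{\psi_s}(\cdot;\tilde z_{j-1})+\psi_n+\frac\mu2\|\cdot-\tilde z_{j-1}\|^2$, $\gamma_j=\tilde\gamma_j(z_j)+(M-\mu)\langle\tilde z_{j-1}-z_j,\cdot-z_j\rangle+\frac\mu2\|\cdot-z_j\|^2$, $\Gamma_j=\frac{B_{j-1}}{B_j}\Gamma_{j-1}+\frac{b_{j-1}}{B_j}\gamma_j$, $r_j=\frac{z_0^c-z_j^c}{B_j}+\mu(z_j-z_j^c)$, $\eta_j=\max\{0,\psi(z_j)-\Gamma_j(z_j^c)-\langle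 r_j,z_j-z_j^c\rangle+\frac\mu2\|z_j-z_j^c\|^2\}$. Step 3: if $\frac1{1+\mu B_j}\|B_jr_j+z_j-z_0\|^2+2B_j\eta_j\le\|z_j-z_0\|^2$ go to step 4; otherwise stop with failure. Step 4: if $\|r_j\|^2+2\eta_j\le\theta^2\|z_j-z_0\|^2$ go to step 5; otherwise set $j\leftarrow j+1$ and go to step 1. Step 5: set $(y,v,\varepsilon)=(z_j,r_j,\eta_j)$ and $(y_r,v_r)=RP(y,v)$; if $\Delta_\mu(y_r;y,v)\le\varepsilon$ stop with success and output $(y,v,\varepsilon)$; otherwise stop with failure. Spectral R-ACG algorithm. Step 1: compute $Z_0^\lambda:=Z_0-\lambda\nabla f_1(Z_0)$ and orthogonal (real unitary) matrices $P\in\mathbb R^{m\times m}$, $Q\in\mathbb R^{n\times n}$ with $Z_0^\lambda=P[\operatorname{dg}\sigma(Z_0^\lambda)]Q^*$. Step 2: run R-ACG on $\mathbb R^r$ with $\mu=1$, $M=\lambda M_2^++1$, $\psi_s^{\mathcal V}=\lambda f_2^{\mathcal V}-\langle\sigma(Z_0^\lambda),\cdot\rangle+\frac12\|\cdot\|^2$, $\psi_n^{\mathcal V}=\lambda h^{\mathcal V}$ in place of $(\psi_s,\psi_n)$, tolerance $\theta$, and starting point $z_0=\operatorname{Dg}(P^*Z_0Q)$; if it fails, stop with failure; otherwise let $(y,v,\varepsilon)$ be its output. Step 3: output (success) $(Y,V,\varepsilon)$ with $Y=P(\operatorname{dg}y)Q^*$ and $V=P(\operatorname{dg}v)Q^*$.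 *)

(* Defs.v *)
From HB Require Import structures.
From mathcomp Require Import all_boot all_order all_fingroup all_algebra.
From mathcomp Require Import all_classical all_reals all_analysis.
From mathcomp Require Import polyrcf.
Set Implicit Arguments.
Unset Strict Implicit.
Unset Printing Implicit Defensive.
Import Order.TTheory GRing.Theory Num.Theory.
Import numFieldNormedType.Exports.
Local Open Scope classical_set_scope.
Local Open Scope ring_scope.

(* The inner product spaces in play are R^(p x q) with the trace inner product;
   R^k is the case 'rV_k = 'M_(1, k), where it is the dot product. The norm
   `|A| that MathComp-Analysis puts on matrices is the max norm: it is only used
   here through the topology it induces, and all metric quantities are
   expressed with fnorm. *)
Definition inner (R : realType) (p q : nat) (A B : 'M[R]_(p, q)) : R :=
  \tr (A^T *m B).

Definition fnorm (R : realType) (p q : nat) (A : 'M[R]_(p, q)) : R :=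
  Num.sqrt (inner A A).

(* The gradient for the inner product above: for f differentiable at x,
   'd f x H = inner (grad f x) H. *)
Definition grad (R : realType) (p q : nat) (f : 'M[R]_(p, q) -> R)
    (x : 'M[R]_(p, q)) : 'M[R]_(p, q) :=
  \matrix_(i, j) 'D_(delta_mx i j) f x.

Definition continuously_differentiable (R : realType) (p q : nat)
    (f : 'M[R]_(p, q) -> R) : Prop :=
  (forall x, differentiable f x) /\ continuous (grad f).

(* l_f(u; y), with the base point y first. *)
Definition linearization (R : realType) (p q : nat) (f : 'M[R]_(p, q) -> R)
    (y u : 'M[R]_(p, q)) : R :=
  f y + inner (grad f y) (u - y).

Definition dom (R : realType) (T : Type) (g : T -> \bar R) : set T :=
  [set u | (g u < +oo)%E].

Definition curvature_bounded_on (R : realType) (p q : nat)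
    (D : set 'M[R]_(p, q)) (lo up : R) (f : 'M[R]_(p, q) -> R) : Prop :=
  forall u y, D u -> D y ->
    - (lo / 2) * fnorm (u - y) ^+ 2 <= f u - linearization f y u
    <= up / 2 * fnorm (u - y) ^+ 2.

Definition lipschitz_grad_on (R : realType) (p q : nat)
    (D : set 'M[R]_(p, q)) (L : R) (f : 'M[R]_(p, q) -> R) : Prop :=
  forall u y, D u -> D y ->
    fnorm (grad f u - grad f y) <= L * fnorm (u - y).

(* In \bar R, 0 * +oo = 0, so the cases t = 0 and t = 1 are harmless. *)
Definition convex_efun (R : realType) (p q : nat)
    (g : 'M[R]_(p, q) -> \bar R) : Prop :=
  forall (x y : 'M[R]_(p, q)) (t : R), 0 <= t <= 1 ->
    (g (t *: x + (1 - t) *: y)%R <= t%:E * g x + (1 - t)%:E * g y)%E.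

Definition proper_lsc_convex (R : realType) (p q : nat)
    (g : 'M[R]_(p, q) -> \bar R) : Prop :=
  [/\ forall u, (-oo < g u)%E, dom g !=set0, lower_semicontinuous g
    & convex_efun g].

Definition absolutely_symmetric (R : realType) (k : nat) (T : Type)
    (f : 'rV[R]_k -> T) : Prop :=
  (forall (s : 'S_k) (u : 'rV[R]_k), f (col_perm s u) = f u) /\
  (forall (e : 'I_k -> bool) (u : 'rV[R]_k),
     f (\row_i ((-1) ^+ e i * u 0 i)) = f u).

Definition argmin (R : realType) (T : Type) (F : T -> \bar R) : set T :=
  [set u | forall w, (F u <= F w)%E].

Definition eps_subdiff (R : realType) (p q : nat)
    (g : 'M[R]_(p, q) -> \bar R) (eps : R) (y : 'M[R]_(p, q)) :
    set 'M[R]_(p, q) :=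
  [set w | forall u, (g y + (inner w (u - y) - eps)%:E <= g u)%E].

Definition dg (R : realType) (m n : nat) (z : 'rV[R]_(minn m n)) :
    'M[R]_(m, n) :=
  \sum_(k < minn m n) z 0 k *:
    delta_mx (widen_ord (geq_minl m n) k) (widen_ord (geq_minr m n) k).

Definition Dg (R : realType) (m n : nat) (Z : 'M[R]_(m, n)) :
    'rV[R]_(minn m n) :=
  \row_k Z (widen_ord (geq_minl m n) k) (widen_ord (geq_minr m n) k).

Definition orthogonal_mx (R : realType) (k : nat) (P : 'M[R]_k) : Prop :=
  P *m P^T = 1%:M.

(* Real eigenvalues, repeated according to their algebraic multiplicity
   and listed in nonincreasing order. *)
Definition eigenvalues (R : realType) (k : nat) (A : 'M[R]_k) : seq R :=
  let p := char_poly A in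
  sort >=%R (flatten [seq nseq (mup x p) x | x <- rootsR p]).

(* U^T U is positive semidefinite of size n, so its list of eigenvalues has n
   entries, all >= 0, and those of index >= minn m n vanish. *)
Definition singular_values (R : realType) (m n : nat) (U : 'M[R]_(m, n)) :
    'rV[R]_(minn m n) :=
  \row_k Num.sqrt (nth 0 (eigenvalues (U^T *m U)) k).

Section CompositeProblem.
Context (R : realType) (p q : nat).
Local Notation Z := 'M[R]_(p, q).
Implicit Types (psi_s : Z -> R) (psi_n : Z -> \bar R).

Definition composite psi_s psi_n (u : Z) : \bar R := ((psi_s u)%:E + psi_n u)%E.

Definition Delta (mu : R) psi_s psi_n (u y v : Z) : \bar R :=
  (composite psi_s psi_n y - composite psi_s psi_n u
   - (inner v (y - u))%:E + (mu / 2 * fnorm (u - y) ^+ 2)%:E)%E.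

(* RP M psi_s psi_n y v yr vr says that (yr, vr) = RP(y, v). *)
Definition RP (M : R) psi_s psi_n (y v yr vr : Z) : Prop :=
  argmin (fun u =>
    (inner (grad psi_s y - v) u + M / 2 * fnorm (u - y) ^+ 2)%:E + psi_n u)%E
    = [set yr] /\
  vr = v + M *: (y - yr) + grad psi_s yr - grad psi_s y.

Definition solves_problem_A (mu : R) psi_s psi_n (theta : R) (z0 y v : Z)
    (eps : R) : Prop :=
  [/\ dom (composite psi_s psi_n) y,
      0 <= eps,
      eps_subdiff (fun u =>
        composite psi_s psi_n u - (mu / 2 * fnorm (u - y) ^+ 2)%:E)%E eps y v
    & fnorm v ^+ 2 + 2 * eps <= theta ^+ 2 * fnorm (y - z0) ^+ 2].

Definition solves_problem_B (mu M : R) psi_s psi_n (theta : R) (z0 y v : Z)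
    (eps : R) : Prop :=
  [/\ dom (composite psi_s psi_n) y,
      0 <= eps,
      fnorm v ^+ 2 + 2 * eps <= theta ^+ 2 * fnorm (y - z0) ^+ 2
    & exists yr vr, RP M psi_s psi_n y v yr vr /\
        (Delta mu psi_s psi_n yr y v <= eps%:E)%E].

End CompositeProblem.

(* The method as a function of the sequence z of its iterates: every other
   quantity is determined by z, and racg_output requires each z_(i+1) to be the
   minimizer computed in step 1. *)
Section RACG.
Context (R : realType) (p q : nat).
Local Notation Z := 'M[R]_(p, q).
Implicit Types (mu M theta : R) (psi_s : Z -> R) (psi_n : Z -> \bar R).
Implicit Types (z : nat -> Z) (i j k : nat).

Definition racg_step mu M (B : R) : R :=
  let xi := (1 + mu * B) / (M - mu) in
  (xi + Num.sqrt (xi ^+ 2 + 4 * xi * B)) / 2.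

Fixpoint racg_B mu M j : R :=
  if j is i.+1 then racg_B mu M i + racg_step mu M (racg_B mu M i) else 0.

Definition racg_b mu M i : R := racg_step mu M (racg_B mu M i).

Definition racg_mix mu M z i (c : Z) : Z :=
  (racg_B mu M i / racg_B mu M i.+1) *: z i
  + (racg_b mu M i / racg_B mu M i.+1) *: c.

Fixpoint racg_zc mu M z j : Z :=
  if j is i.+1 then
    let c := racg_zc mu M z i in
    (1 + mu * racg_B mu M i.+1)^-1 *:
      (c - (racg_b mu M i * (M - mu)) *: (racg_mix mu M z i c - z i.+1)
       + mu *: (racg_B mu M i *: c + racg_b mu M i *: z i.+1))
  else z 0.

Definition racg_ztilde mu M z i : Z := racg_mix mu M z i (racg_zc mu M z i).

(* racg_gammat and racg_gamma at index i are the functions of index i + 1. *)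
Definition racg_gammat mu M psi_s psi_n z i (u : Z) : \bar R :=
  let zt := racg_ztilde mu M z i in
  ((linearization psi_s zt u)%:E + psi_n u
   + (mu / 2 * fnorm (u - zt) ^+ 2)%:E)%E.

Definition racg_gamma mu M psi_s psi_n z i (u : Z) : \bar R :=
  (racg_gammat mu M psi_s psi_n z i (z i.+1)
   + ((M - mu) * inner (racg_ztilde mu M z i - z i.+1) (u - z i.+1)
      + mu / 2 * fnorm (u - z i.+1) ^+ 2)%:E)%E.

Fixpoint racg_Gamma mu M psi_s psi_n z j (u : Z) : \bar R :=
  if j is i.+1 then
    ((racg_B mu M i / racg_B mu M i.+1)%:E * racg_Gamma mu M psi_s psi_n z i u
     + (racg_b mu M i / racg_B mu M i.+1)%:E
       * racg_gamma mu M psi_s psi_n z i u)%E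
  else 0%E.

Definition racg_r mu M z j : Z :=
  (racg_B mu M j)^-1 *: (z 0 - racg_zc mu M z j)
  + mu *: (z j - racg_zc mu M z j).

Definition racg_eta mu M psi_s psi_n z j : \bar R :=
  let c := racg_zc mu M z j in
  maxe 0%E
    (composite psi_s psi_n (z j) - racg_Gamma mu M psi_s psi_n z j c
     - (inner (racg_r mu M z j) (z j - c))%:E
     + (mu / 2 * fnorm (z j - c) ^+ 2)%:E)%E.

(* z_0, ..., z_k are the iterates produced by step 1 from z0. *)
Definition racg_iterates mu M psi_s psi_n (z0 : Z) z k : Prop :=
  z 0 = z0 /\
  forall i, (i < k)%N ->
    let zt := racg_ztilde mu M z i in
    argmin (fun u => (linearization psi_s zt u)%:E + psi_n u
                     + (M / 2 * fnorm (u - zt) ^+ 2)%:E)%E = [set z i.+1].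

Definition racg_test3 mu M psi_s psi_n z j : Prop :=
  let B := racg_B mu M j in
  (((1 + mu * B)^-1 * fnorm (B *: racg_r mu M z j + z j - z 0) ^+ 2)%:E
   + (2 * B)%:E * racg_eta mu M psi_s psi_n z j
   <= (fnorm (z j - z 0) ^+ 2)%:E)%E.

Definition racg_test4 mu M psi_s psi_n theta z j : Prop :=
  ((fnorm (racg_r mu M z j) ^+ 2)%:E + 2%:E * racg_eta mu M psi_s psi_n z j
   <= (theta ^+ 2 * fnorm (z j - z 0) ^+ 2)%:E)%E.

(* R-ACG stops with success and outputs (y, v, eps); k is the iteration at which
   the test of step 4 holds for the first time. *)
Definition racg_output mu M psi_s psi_n theta (z0 y v : Z) (eps : R) : Prop :=
  exists (k : nat) (z : nat -> Z),
    [/\ (0 < k)%N /\ racg_iterates mu M psi_s psi_n z0 z k,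
        forall j, (0 < j <= k)%N -> racg_test3 mu M psi_s psi_n z j,
        (forall j, (0 < j < k)%N -> ~ racg_test4 mu M psi_s psi_n theta z j) /\
        racg_test4 mu M psi_s psi_n theta z k,
        [/\ y = z k, v = racg_r mu M z k
          & eps%:E = racg_eta mu M psi_s psi_n z k]
      & exists yr vr, RP M psi_s psi_n y v yr vr /\
          (Delta mu psi_s psi_n yr y v <= eps%:E)%E].

End RACG.

Section SpectralRACG.
Context (R : realType) (m n : nat).

Definition shifted_point (f1 : 'M[R]_(m, n) -> R) (lambda : R)
    (Z0 : 'M[R]_(m, n)) : 'M[R]_(m, n) :=
  Z0 - lambda *: grad f1 Z0.

(* (P, Q) is an admissible result of step 1. *)
Definition spectral_racg_svd (f1 : 'M[R]_(m, n) -> R) (lambda : R)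
    (Z0 : 'M[R]_(m, n)) (P : 'M[R]_m) (Q : 'M[R]_n) : Prop :=
  let W := shifted_point f1 lambda Z0 in
  [/\ orthogonal_mx P, orthogonal_mx Q
    & W = P *m dg (singular_values W) *m Q^T].

Definition psi_sV (f1 : 'M[R]_(m, n) -> R) (f2V : 'rV[R]_(minn m n) -> R)
    (lambda : R) (Z0 : 'M[R]_(m, n)) (u : 'rV[R]_(minn m n)) : R :=
  lambda * f2V u
  - inner (singular_values (shifted_point f1 lambda Z0)) u
  + 2^-1 * fnorm u ^+ 2.

(* Having chosen (P, Q) in step 1, the spectral method stops with success and
   outputs (Y, V, eps). *)
Definition spectral_racg_output (f1 : 'M[R]_(m, n) -> R)
    (f2V : 'rV[R]_(minn m n) -> R) (hV : 'rV[R]_(minn m n) -> \bar R)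
    (lambda M2 theta : R)
    (Z0 : 'M[R]_(m, n)) (P : 'M[R]_m) (Q : 'M[R]_n)
    (Y V : 'M[R]_(m, n)) (eps : R) : Prop :=
  exists y v : 'rV[R]_(minn m n),
    [/\ racg_output 1 (lambda * Num.max M2 0 + 1)
          (psi_sV f1 f2V lambda Z0) (fun u => (lambda%:E * hV u)%E)
          theta (Dg (P^T *m Z0 *m Q)) y v eps,
        Y = P *m dg y *m Q^T
      & V = P *m dg v *m Q^T].

End SpectralRACG.

(* Main.v *)
Require Import Defs.
From HB Require Import structures.
From mathcomp Require Import all_boot all_order all_algebra fingroup perm.
From mathcomp Require Import all_classical all_reals all_analysis.
From mathcomp Require Import polyrcf ring lra.
Set Implicit Arguments.
Unset Strict Implicit.
Unset Printing Implicit Defensive.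
Import Order.TTheory GRing.Theory Num.Theory.
Import numFieldNormedType.Exports.
Local Open Scope classical_set_scope.
Local Open Scope ring_scope.

(* Two consequences of von Neumann's trace inequality
   <P dg(s) Q^T, U> <= <s, u>, for a suitable signed permutation u of sigma(U),
   carry the proof. Let f be absolutely symmetric.
   - An eps-subgradient s of f at y lifts to the eps-subgradient P dg(s) Q^T of
     f o sigma at P dg(y) Q^T. Applied to the minimality condition of y_r this
     identifies RP on matrices with RP on vectors, and applied to the output of
     R-ACG it gives the inclusion of Problem A.
   - If f is differentiable at y, so is f o sigma at P dg(y) Q^T, with gradient
     P dg(grad f(y)) Q^T.
   Since W = P dg(sigma(W)) Q^T for W = Z_0 - lambda grad f_1(Z_0), the composite
   functions on R^(m x n) and on R^r then agree along y |-> P dg(y) Q^T up to an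
   additive constant.
   When f_2 is convex, psi_s is 1-strongly convex, the models Gamma_j are lower
   bounds of psi and B_j psi(z_j) <= min (B_j Gamma_j + |. - z_0|^2 / 2). This is
   the test of step 3; it bounds |r_j|^2 + 2 eta_j by O(1 / B_j) |z_j - z_0|^2,
   and B_j tends to infinity. *)

(** * Trace inner product *)

(** [singular_values] is defined by roots of a characteristic polynomial, whereas the argument lives
    on decompositions P dg(a) Q^T. The bridge is [singular_values_nonincreasing_dg]: when a is
    sorted and nonnegative, such a decomposition has sigma = a. The vectors y and v of the vector
    method are in general neither sorted nor nonnegative. So von Neumann's inequality is needed for
    arbitrary s, at the price of a signed permutation of sigma(U), which an absolutely symmetric
    function does not see. P and Q diagonalize W but not Z_0, so the vector method starts from the
    mere diagonal of P^T Z_0 Q. Dropping the other entries can only shrink the distance to the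
    starting point, so the tolerance test on vectors implies the one on matrices. In part (a), where
    f_2 may be nonconvex, RP still lifts: its subproblem linearizes psi_s and adds a proximal term,
    so it is strongly convex, and its optimality condition is a subgradient of psi_n alone. *)

Section Inner.
Context {R : realType} {p q : nat}.
Implicit Types A B C : 'M[R]_(p, q).

Lemma innerE A B : inner A B = \sum_i \sum_j A i j * B i j.
Proof.
rewrite /inner /mxtrace exchange_big /=; apply: eq_bigr => j _.
by rewrite mxE; apply: eq_bigr => i _; rewrite mxE.
Qed.

Lemma innerC A B : inner A B = inner B A.
Proof.
by rewrite !innerE; apply: eq_bigr => i _; apply: eq_bigr => j _; rewrite mulrC.
Qed.

Lemma innerDl A B C : inner (A + B) C = inner A C + inner B C.
Proof. by rewrite /inner linearD /= mulmxDl mxtraceD. Qed.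

Lemma innerZl k A B : inner (k *: A) B = k * inner A B.
Proof. by rewrite /inner linearZ /= -scalemxAl mxtraceZ. Qed.

Lemma innerNl A B : inner (- A) B = - inner A B.
Proof. by rewrite -scaleN1r innerZl mulN1r. Qed.

Lemma innerDr A B C : inner A (B + C) = inner A B + inner A C.
Proof. by rewrite innerC innerDl ![inner _ A]innerC. Qed.

Lemma innerZr k A B : inner A (k *: B) = k * inner A B.
Proof. by rewrite innerC innerZl innerC. Qed.

Lemma innerNr A B : inner A (- B) = - inner A B.
Proof. by rewrite innerC innerNl innerC. Qed.

Lemma inner0l A : inner 0 A = 0.
Proof. by rewrite -(scale0r 0) innerZl mul0r. Qed.

Lemma inner0r A : inner A 0 = 0.
Proof. by rewrite innerC inner0l. Qed.

Definition innerlin :=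
  (innerDl, innerDr, innerNl, innerNr, innerZl, innerZr, inner0l, inner0r).

Lemma inner_ge0 A : 0 <= inner A A.
Proof.
by rewrite innerE; do 2!apply: sumr_ge0 => ? _; rewrite -expr2 sqr_ge0.
Qed.

Lemma entry2_le_inner A i j : A i j ^+ 2 <= inner A A.
Proof.
rewrite innerE (bigD1 i) //= (bigD1 j) //= -addrA -expr2 lerDl addr_ge0 //.
  by apply: sumr_ge0 => k _; rewrite -expr2 sqr_ge0.
by do 2!apply: sumr_ge0 => ? _; rewrite -expr2 sqr_ge0.
Qed.

Lemma inner_eq0 A : inner A A = 0 -> A = 0.
Proof.
move=> A0; apply/matrixP => i j; apply/eqP; rewrite mxE -sqrf_eq0.
by rewrite eq_le sqr_ge0 -A0 entry2_le_inner.
Qed.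

Lemma fnorm2 A : fnorm A ^+ 2 = inner A A.
Proof. by rewrite sqr_sqrtr // inner_ge0. Qed.

Lemma fnorm_ge0 A : 0 <= fnorm A.
Proof. exact: sqrtr_ge0. Qed.

Lemma fnorm_eq0 A : fnorm A = 0 -> A = 0.
Proof. by move=> A0; apply: inner_eq0; rewrite -fnorm2 A0 expr0n. Qed.

Lemma fnormZ k A : fnorm (k *: A) = `|k| * fnorm A.
Proof. by rewrite /fnorm !innerlin mulrA -expr2 sqrtrM ?sqr_ge0 // sqrtr_sqr. Qed.

Lemma fnormN A : fnorm (- A) = fnorm A.
Proof. by rewrite /fnorm !innerlin opprK. Qed.

Lemma fnorm0 : fnorm (0 : 'M[R]_(p, q)) = 0.
Proof. by rewrite /fnorm inner0l sqrtr0. Qed.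

Lemma inner_CS A B : inner A B <= fnorm A * fnorm B.
Proof.
have := inner_ge0 (fnorm B *: A - fnorm A *: B).
rewrite !innerlin -!fnorm2 [inner B A]innerC.
have := fnorm_ge0 A; have := fnorm_ge0 B.
rewrite le0r => /orP[/eqP/fnorm_eq0 ->|B0].
  by move=> _ _; rewrite inner0r fnorm0 mulr0.
rewrite le0r => /orP[/eqP/fnorm_eq0 ->|A0].
  by move=> _; rewrite inner0l fnorm0 mul0r.
move=> h; rewrite -(ler_pM2l (mulr_gt0 A0 B0)).
by move: h; lra.
Qed.

Lemma normr_inner A B : `|inner A B| <= fnorm A * fnorm B.
Proof.
by rewrite ler_norml inner_CS andbT lerNl -innerNl -[fnorm A]fnormN inner_CS.
Qed.

Lemma fnormD A B : fnorm (A + B) <= fnorm A + fnorm B.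
Proof.
rewrite -(@ler_pXn2r _ 2) ?nnegrE ?addr_ge0 ?fnorm_ge0 //.
rewrite fnorm2 !innerlin -!fnorm2 [inner B A]innerC.
by have := inner_CS A B; lra.
Qed.

Lemma normr_entry_le_fnorm A i j : `|A i j| <= fnorm A.
Proof. by rewrite -sqrtr_sqr ler_sqrt ?inner_ge0 // entry2_le_inner. Qed.

(** Bridge from the max norm, which carries the topology, to [fnorm]: it transfers boundedness and
    the remainder estimate of a differential. *)
Lemma mx_norm_le_fnorm A : `|A| <= fnorm A.
Proof.
rewrite /Num.norm /= mx_normrE; apply: bigmax_le; first exact: fnorm_ge0.
by move=> [i j] _; exact: normr_entry_le_fnorm.
Qed.

End Inner.

Section Orthogonal.
Context {R : realType}.

Lemma orthogonal_mxC k (P : 'M[R]_k) : orthogonal_mx P -> P^T *m P = 1%:M.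
Proof. exact: mulmx1C. Qed.

Lemma orthogonal_trmx k (P : 'M[R]_k) : orthogonal_mx P -> orthogonal_mx P^T.
Proof. by move=> /orthogonal_mxC; rewrite /orthogonal_mx trmxK. Qed.

Lemma orthogonal_mul k (P Q : 'M[R]_k) :
  orthogonal_mx P -> orthogonal_mx Q -> orthogonal_mx (P *m Q).
Proof.
by move=> hP hQ; rewrite /orthogonal_mx trmx_mul mulmxA -(mulmxA P) hQ mulmx1.
Qed.

Lemma orthogonal1 k : orthogonal_mx (1%:M : 'M[R]_k).
Proof. by rewrite /orthogonal_mx trmx1 mulmx1. Qed.

Lemma inner_mulmx p q (P : 'M[R]_p) (Q : 'M[R]_q) (A B : 'M[R]_(p, q)) :
  inner (P *m A *m Q^T) B = inner A (P^T *m B *m Q).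
Proof.
by rewrite /inner !trmx_mul trmxK -!mulmxA mxtrace_mulC !mulmxA.
Qed.

Lemma inner_orthogonal p q (P : 'M[R]_p) (Q : 'M[R]_q) (A B : 'M[R]_(p, q)) :
  orthogonal_mx P -> orthogonal_mx Q ->
  inner (P *m A *m Q^T) (P *m B *m Q^T) = inner A B.
Proof.
move=> /orthogonal_mxC hP /orthogonal_mxC hQ.
by rewrite inner_mulmx !mulmxA hP mul1mx -mulmxA hQ mulmx1.
Qed.

Lemma fnorm_orthogonal p q (P : 'M[R]_p) (Q : 'M[R]_q) (A : 'M[R]_(p, q)) :
  orthogonal_mx P -> orthogonal_mx Q -> fnorm (P *m A *m Q^T) = fnorm A.
Proof. by move=> hP hQ; rewrite /fnorm inner_orthogonal. Qed.

End Orthogonal.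

Section Diagonal.
Context {R : realType} {m n : nat}.
Local Notation r := (minn m n).
Implicit Types (a b z : 'rV[R]_r) (Z : 'M[R]_(m, n)).
Local Notation wm := (widen_ord (geq_minl m n)).
Local Notation wn := (widen_ord (geq_minr m n)).

Lemma dg_linear : linear (@dg R m n).
Proof.
move=> k a b; rewrite /dg scaler_sumr -big_split /=; apply: eq_bigr => i _.
by rewrite !mxE scalerDl scalerA.
Qed.
HB.instance Definition _ :=
  GRing.isLinear.Build R _ _ _ (@dg R m n) dg_linear.

Lemma Dg_linear : linear (@Dg R m n).
Proof. by move=> k A B; apply/rowP => i; rewrite !mxE. Qed.
HB.instance Definition _ :=
  GRing.isLinear.Build R _ _ _ (@Dg R m n) Dg_linear.

Lemma dg_entry a i j : dg a i j = \sum_k a 0 k * ((i == wm k) && (j == wn k))%:R.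
Proof. by rewrite /dg summxE; apply: eq_bigr => k _; rewrite !mxE. Qed.

Lemma dgEdiag a k : dg a (wm k) (wn k) = a 0 k.
Proof.
rewrite dg_entry (bigD1 k) //= !eqxx mulr1 big1 ?addr0 // => l.
by rewrite eq_sym => lk; rewrite -val_eqE /= val_eqE (negPf lk) mulr0.
Qed.

Lemma dgE0 a (i : 'I_m) (j : 'I_n) : i != j :> nat -> dg a i j = 0.
Proof.
move=> ij; rewrite dg_entry big1 // => k _.
case: eqP => [iE|]; rewrite ?mulr0 //=; case: eqP => [jE|]; rewrite ?mulr0 //.
by move: ij; rewrite iE jE eqxx.
Qed.

Lemma dgK : cancel (@dg R m n) (@Dg R m n).
Proof. by move=> a; apply/rowP => k; rewrite mxE dgEdiag. Qed.

Lemma DgK Z : (forall (i : 'I_m) (j : 'I_n), i != j :> nat -> Z i j =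
    0) -> dg (Dg Z) = Z.
Proof.
move=> Z0; apply/matrixP => i j; have [ij|ij] := eqVneq (i : nat) j; last first.
  by rewrite dgE0 // Z0.
have ir : (i < r)%N by rewrite leq_min ltn_ord ij ltn_ord.
have -> : i = wm (Ordinal ir) by exact/val_inj.
have -> : j = wn (Ordinal ir) by exact/val_inj.
by rewrite dgEdiag mxE.
Qed.

Lemma inner_dgl a Z : inner (dg a) Z = inner a (Dg Z).
Proof.
rewrite innerE [RHS]innerE big_ord1.
transitivity (\sum_(k < r) \sum_i \sum_j
    a 0 k * ((i == wm k) && (j == wn k))%:R * Z i j).
  rewrite [RHS]exchange_big; apply: eq_bigr => i _ /=.
  rewrite [RHS]exchange_big; apply: eq_bigr => j _ /=.
  by rewrite dg_entry mulr_suml.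
apply: eq_bigr => k _; rewrite (bigD1 (wm k)) //= (bigD1 (wn k)) //= !big1.
- by rewrite !eqxx mulr1 !addr0 mxE.
- by move=> i ik; apply: big1 => j _; rewrite (negPf ik) mulr0 mul0r.
- by move=> j jk; rewrite (negPf jk) andbF mulr0 mul0r.
Qed.

Lemma inner_dg a b : inner (dg a) (dg b) = inner a b.
Proof. by rewrite inner_dgl dgK. Qed.

Lemma fnorm_dg a : fnorm (dg a) = fnorm a.
Proof. by rewrite /fnorm inner_dg. Qed.

(** [Dg] is the adjoint of the isometry [dg], hence a contraction. *)
Lemma fnorm_Dg Z : fnorm (Dg Z) <= fnorm Z.
Proof.
have [/eqP ->|d0] := boolP (fnorm (Dg Z) == 0); first exact: fnorm_ge0.
have {}d0 : 0 < fnorm (Dg Z) by rewrite lt0r d0 fnorm_ge0.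
rewrite -(ler_pM2l d0) -expr2 fnorm2 -inner_dgl -[X in _ <= X * _]fnorm_dg.
exact: inner_CS.
Qed.

End Diagonal.

(** * Orthogonal reduction of a matrix to diagonal form *)

Section SVD.
Context {R : realType}.

Lemma inner_col_mx m1 m2 k (A C : 'M[R]_(m1, k)) (B D : 'M[R]_(m2, k)) :
  inner (col_mx A B) (col_mx C D) = inner A C + inner B D.
Proof. by rewrite /inner tr_col_mx mul_row_col mxtraceD. Qed.

Lemma inner_scalar (a b : R) : inner (a%:M : 'M[R]_1) b%:M = a * b.
Proof. by rewrite innerE !big_ord1 !mxE. Qed.

Lemma orthogonal_first_col k (u : 'cV[R]_(1 + k)) : inner u u = 1 ->
  exists P : 'M[R]_(1 + k), orthogonal_mx P /\ P *m col_mx 1%:M 0 = u.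
Proof.
move=> u1; set e : 'cV[R]_(1 + k) := col_mx 1%:M 0.
have e1 : inner e e = 1 by rewrite inner_col_mx inner_scalar inner0l addr0 mulr1.
(* P is the Householder reflection exchanging e and u. *)
pose w := u - e; have [/eqP|w0] := eqVneq (inner w w) 0.
  move=> /eqP/inner_eq0/eqP; rewrite subr_eq0 => /eqP ue.
  by exists 1%:M; rewrite mul1mx ue; split => //; exact: orthogonal1.
have mulT (a b : 'cV[R]_(1 + k)) : a^T *m b = (inner a b)%:M.
  by rewrite [LHS]mx11_scalar /inner /mxtrace big_ord1.
pose c := 2 / inner w w.
exists (1%:M - c *: (w *m w^T)); split.
  have HT : (1%:M - c *: (w *m w^T))^T = 1%:M - c *: (w *m w^T).
    by rewrite raddfB /= linearZ /= trmx1 trmx_mul trmxK.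
  rewrite /orthogonal_mx HT.
  have XX : w *m w^T *m (w *m w^T) = inner w w *: (w *m w^T).
    by rewrite -mulmxA [w^T *m _]mulmxA mulT mul_scalar_mx -scalemxAr.
  rewrite mulmxBl mul1mx mulmxBr mulmx1 -scalemxAl -scalemxAr XX !scalerA.
  rewrite (_ : c * _ * _ = c + c); first by rewrite scalerDl opprB addrK subrK.
  by rewrite /c; field.
rewrite mulmxBl mul1mx -scalemxAl -mulmxA mulT mul_mx_scalar scalerA.
(* Since u and e have the same norm, <w, e> = -|w|^2 / 2, so the reflection sends e to e + w = u. *)
have -> : c * inner w e = -1.
  have ww : inner w w = - 2 * inner w e.
    by rewrite /w !innerlin u1 e1 [inner e u]innerC; ring.
  by move: w0; rewrite /c ww => w0; field; move: w0; rewrite mulf_eq0; case: eqP.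
by rewrite scaleN1r opprK addrC subrK.
Qed.

Lemma continuous_inner_mulmx p q (B : 'M[R]_(p, q)) :
  continuous (fun v : 'rV[R]_p => inner (v *m B) (v *m B)).
Proof.
have sumc k (F : 'I_k -> 'rV[R]_p -> R) : (forall i, continuous (F i)) ->
    continuous (fun v => \sum_i F i v).
  by move=> Fc; apply: continuous_big => //; exact: add_continuous.
have entry j : continuous (fun v : 'rV[R]_p => (v *m B) 0 j).
  under eq_fun do rewrite mxE.
  by apply: sumc => i v; apply: continuousM;
    [exact: coord_continuous|exact: cst_continuous].
under eq_fun do rewrite innerE big_ord1.
by apply: sumc => i v; apply: continuousM; exact: entry.
Qed.

Lemma continuous_inner n : continuous (fun v : 'rV[R]_n => inner v v).
Proof.
rewrite (_ : (fun v => _) = (fun v : 'rV_n => inner (v *m 1%:M) (v *m 1%:M))).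
  exact: continuous_inner_mulmx.
by apply/funext => v; rewrite mulmx1.
Qed.

Lemma bounded_fnorm n (A : set 'rV[R]_n) (M : R) :
  (forall v, A v -> fnorm v <= M) -> bounded_set A.
Proof.
move=> hA; exists M; split; first exact: num_real.
move=> x Mx v Av; apply: le_trans (mx_norm_le_fnorm v) _.
exact: le_trans (hA _ Av) (ltW Mx).
Qed.

Lemma compact_sphere n : compact [set v : 'rV[R]_n | inner v v = 1].
Proof.
apply: bounded_closed_compact.
  apply: (@bounded_fnorm _ _ 1) => v /= v1.
  by rewrite /fnorm v1 sqrtr1.
apply: (@preimage_closed _ _ (fun v : 'rV[R]_n => inner v v) [set 1]); last first.
  exact: closed_eq.
by move=> v _; exact: continuous_inner.
Qed.

(* By maximality of |A v|, once v and A v are rotated onto first basis vectors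
   the rest of the first row of A vanishes. *)
Lemma max_dilation m n (A : 'M[R]_(m, 1 + n)) : exists2 v : 'cV[R]_(1 + n),
  inner v v = 1 &
  forall w : 'cV[R]_(1 + n),
    inner (A *m w) (A *m w) <= inner (A *m v) (A *m v) * inner w w.
Proof.
have innerT p q (X Y : 'M[R]_(p, q)) : inner X^T Y^T = inner X Y.
  by rewrite /inner -trmx_mul mxtrace_tr mxtrace_mulC.
have S0 : [set v : 'rV[R]_(1 + n) | inner v v = 1] !=set0.
  exists (row_mx 1%:M 0) => /=; rewrite -innerT tr_row_mx trmx1 trmx0.
  by rewrite inner_col_mx inner_scalar inner0l mulr1 addr0.
have cont : {within [set v : 'rV[R]_(1 + n) | inner v v = 1],
    continuous (fun v => inner (v *m A^T) (v *m A^T))}.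
  by apply: continuous_subspaceT => v; exact: continuous_inner_mulmx.
have [v] := EVT_max_rV S0 (@compact_sphere _) cont.
rewrite inE /= => v1 vmax; exists v^T; first by rewrite innerT.
move=> w; have [w0|w0] := eqVneq (inner w w) 0.
  by rewrite (inner_eq0 w0) mulmx0 !inner0l mulr0.
have wn : 0 < fnorm w by rewrite sqrtr_gt0 lt0r w0 inner_ge0.
have fE (u : 'cV[R]_(1 + n)) :
    inner (A *m u) (A *m u) = inner (u^T *m A^T) (u^T *m A^T).
  by rewrite -!trmx_mul innerT.
have wn0 := lt0r_neq0 wn.
(* The maximum on the unit sphere extends to all w by homogeneity. *)
have := vmax ((fnorm w)^-1 *: w^T); rewrite inE /= !fE trmxK -scalemxAl.
rewrite !innerlin innerT -[inner w w]fnorm2 !mulrA.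
have -> : (fnorm w)^-1 / fnorm w * fnorm w * fnorm w = 1 by field.
move=> /(_ erefl); rewrite -invfM ler_pdivrMl ?mulr_gt0 //.
by rewrite mulrC mulrA.
Qed.

Lemma exists_diagonalizing m n (A : 'M[R]_(m, n)) : exists P Q,
  [/\ orthogonal_mx P, orthogonal_mx Q &
      forall (i : 'I_m) (j : 'I_n), i != j :> nat -> (P^T *m A *m Q) i j = 0].
Proof.
elim: m n A => [|m IH] [|n] A.
- by exists 1%:M, 1%:M; split; try exact: orthogonal1; case.
- by exists 1%:M, 1%:M; split; try exact: orthogonal1; case.
- by exists 1%:M, 1%:M; split; try exact: orthogonal1; move=> i [].
rewrite -[m.+1]/(1 + m)%N -[n.+1]/(1 + n)%N in A *.
have [v v1 vmax] := max_dilation A.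
have [Q1 [Q1o Q1v]] := orthogonal_first_col v1.
pose s := fnorm (A *m v); pose e k : 'cV[R]_(1 + k) := col_mx 1%:M 0.
have [P1 [P1o P1v]] : exists P1, orthogonal_mx P1 /\ P1 *m (s *: e m) = A *m v.
  (* If s = 0 then A v = 0 and there is no direction to rotate, so the identity serves. *)
  have [s0|s0] := eqVneq s 0.
    exists 1%:M; split; first exact: orthogonal1.
    by rewrite s0 scale0r mulmx0 (fnorm_eq0 s0).
  have [|P1 [P1o P1e]] := @orthogonal_first_col m (s^-1 *: (A *m v)).
    by rewrite !innerlin -fnorm2 -/s; field.
  exists P1; split => //.
  by rewrite -scalemxAr P1e scalerA divff // scale1r.
pose B := P1^T *m A *m Q1.
have Be : B *m e n = s *: e m.
  rewrite /B -!mulmxA Q1v -P1v mulmxA orthogonal_mxC //.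
  by rewrite mul1mx.
have BE : B = block_mx s%:M (ursubmx B) 0 (drsubmx B).
  rewrite -[LHS]submxK; congr block_mx; move: Be; rewrite -{1}[B]submxK.
    by rewrite mul_block_col scale_col_mx !mulmx0 !mulmx1 !addr0 =>
        /eq_col_mx[-> _];
       rewrite scalemx1.
  by rewrite mul_block_col scale_col_mx !mulmx0 !mulmx1 !addr0 scaler0 =>
      /eq_col_mx[].
have Bmax (w : 'cV[R]_(1 + n)) : inner (B *m w) (B *m w) <= s ^+ 2 * inner w w.
  have := vmax (Q1 *m w); rewrite -[inner (A *m v) _]fnorm2 -/s.
  have unit k (P : 'M[R]_k) (a : 'cV[R]_k) : orthogonal_mx P ->
      inner (P *m a) (P *m a) = inner a a.
    move=> Po; have := inner_orthogonal a a Po (orthogonal1 1).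
    by rewrite trmx1 !mulmx1.
  rewrite (unit _ Q1) // /B -!mulmxA (unit _ P1^T) //;
  exact: orthogonal_trmx.
set x := ursubmx B in BE; set D := drsubmx B in BE.
have x0 : x = 0.
  pose X := inner x^T x^T.
  (* On the test vector (s, x^T) the first coordinate of the image is s^2 + |x|^2; maximality gives
     (s^2 + |x|^2)^2 <= s^2 (s^2 + |x|^2), which forces x = 0. *)
  have := Bmax (col_mx s%:M x^T); rewrite BE mul_block_col.
  have -> : x *m x^T = X%:M.
    by rewrite [LHS]mx11_scalar /X /inner trmxK /mxtrace big_ord1.
  rewrite mul0mx add0r -scalar_mxM -raddfD !inner_col_mx !inner_scalar -/X => h.
  have X0 : 0 <= X by exact: inner_ge0.
  have D0 := inner_ge0 (D *m x^T).
  apply: trmx_inj; rewrite trmx0; apply: inner_eq0; apply/eqP.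
  rewrite eq_le X0 andbT -/X leNgt; apply/negP => Xgt.
  by have := mulr_gt0 Xgt Xgt; have := mulr_ge0 X0 (sqr_ge0 s); move: h; nra.
have [P2 [Q2 [P2o Q2o diag]]] := IH n D.
exists (P1 *m block_mx 1%:M 0 0 P2), (Q1 *m block_mx 1%:M 0 0 Q2).
have blk k (S : 'M[R]_k) : orthogonal_mx S ->
    orthogonal_mx (block_mx (1%:M : 'M[R]_1) 0 0 S).
  move=> So; rewrite /orthogonal_mx tr_block_mx mulmx_block !trmx0 trmx1.
  by rewrite !mulmx0 !mul0mx !mulmx1 !addr0 add0r So -scalar_mx_block.
split; try by apply: orthogonal_mul => //; exact: blk.
have -> : (P1 *m block_mx 1%:M 0 0 P2)^T *m A *m (Q1 *m block_mx 1%:M 0 0 Q2) =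
    block_mx s%:M 0 0 (P2^T *m D *m Q2).
  rewrite trmx_mul -!mulmxA [A *m _]mulmxA [P1^T *m _]mulmxA [P1^T *m _]mulmxA.
  rewrite -/B BE x0 tr_block_mx !trmx0 trmx1 !mulmx_block.
  by rewrite !(mul0mx, mulmx0, mul1mx, mulmx1, addr0, add0r) mulmxA.
move=> i j; case: (split_ordP i) => i' ->; case: (split_ordP j) => j' -> ij.
- by move: ij; rewrite !ord1 eqxx.
- by rewrite block_mxEur mxE.
- by rewrite block_mxEdl mxE.
- by rewrite block_mxEdr diag //; move: ij; rewrite /= eqn_add2l.
Qed.

End SVD.

(** * Singular values *)

Section SignedPermutations.
Context {R : realType} {r : nat}.
Implicit Types (s : 'S_r) (e : 'I_r -> bool) (a b : 'rV[R]_r).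

Definition signed_perm s e a : 'rV[R]_r := \row_i ((-1) ^+ e i * a 0 (s i)).

Lemma absolutely_symmetric_signed_perm T (f : 'rV[R]_r -> T) s e a :
  absolutely_symmetric f -> f (signed_perm s e a) = f a.
Proof.
move=> [fs fe]; rewrite -[RHS](fs s) -[RHS](fe e); congr f.
by apply/rowP => i; rewrite !mxE.
Qed.

Lemma signed_perm_linear s e : linear (signed_perm s e).
Proof. by move=> k a b; apply/rowP => i; rewrite !mxE mulrDr mulrCA. Qed.
HB.instance Definition _ s e :=
  GRing.isLinear.Build R _ _ _ (signed_perm s e) (signed_perm_linear s e).

Lemma inner_signed_perm s e a b :
  inner (signed_perm s e a) (signed_perm s e b) = inner a b.
Proof.
rewrite !innerE !big_ord1 [RHS](reindex_inj (@perm_inj _ s)) /=.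
by apply: eq_bigr => i _; rewrite !mxE mulrACA -expr2 sqrr_sign mul1r.
Qed.

Lemma fnorm_signed_perm s e a : fnorm (signed_perm s e a) = fnorm a.
Proof. by rewrite /fnorm inner_signed_perm. Qed.

Lemma signed_permV s e : exists s' e',
  cancel (signed_perm s e) (signed_perm s' e') /\
  cancel (signed_perm s' e') (signed_perm s e).
Proof.
exists s^-1%g, (fun i => e (s^-1%g i)); split=> a; apply/rowP => i; rewrite !mxE.
  by rewrite permKV mulrA -expr2 sqrr_sign mul1r.
by rewrite permK mulrA -expr2 sqrr_sign mul1r.
Qed.

(** Nonnegativity is included: this is the cone of possible vectors of singular values. *)
Definition nonincreasing_row a :=
  (forall i j : 'I_r, (i <= j)%N -> a 0 j <= a 0 i) /\ (forall i, 0 <= a 0 i).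

Lemma exists_sorting a : exists s e, nonincreasing_row (signed_perm s e a).
Proof.
pose t := [tuple `|a 0 i| | i < r].
have /tuple_permP[s sE] : perm_eq (sort >=%R t) t by rewrite perm_sort.
exists s, (fun i => a 0 (s i) < 0).
have E i : signed_perm s (fun i => a 0 (s i) < 0) a 0 i = nth 0 (sort >=%R t) i.
  rewrite mxE sE (nth_map i) ?size_enum_ord // nth_ord_enum tnth_mktuple.
  have [h|h] := ltP (a 0 (s i)) 0; first by rewrite mulN1r ltr0_norm.
  by rewrite mul1r ger0_norm.
have szt : size (sort >=%R t) = r by rewrite size_sort size_tuple.
split=> [i j ij|i].
  rewrite !E; apply: (sorted_leq_nth ge_trans ge_refl) => //.
  - by apply: sort_sorted; exact: ge_total.
  - by rewrite inE szt.
  - by rewrite inE szt.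
rewrite mxE; have [h|h] := ltP (a 0 (s i)) 0; last by rewrite mul1r.
by rewrite mulN1r oppr_ge0 ltW.
Qed.

End SignedPermutations.

Section ExtendPermutation.
Context {r N : nat} (rN : (r <= N)%N) (s : 'S_r).

(** Extending at the level of [nat] lets one permutation act compatibly on row indices in 'I_m and
    column indices in 'I_n. *)
Definition extend_nat (i : nat) : nat := if insub i is Some k then s k else i.

Lemma extend_natE (k : 'I_r) : extend_nat k = s k.
Proof. by rewrite /extend_nat valK. Qed.

Lemma extend_nat_lt i : (extend_nat i < r)%N = (i < r)%N.
Proof. by rewrite /extend_nat; case: insubP => // k -> _; rewrite ltn_ord. Qed.

Lemma extend_nat_inj : injective extend_nat.
Proof.
move=> i j; have [ir|] := boolP (i < r)%N; have [jr|] := boolP (j < r)%N.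
- rewrite -[i]/(val (Ordinal ir)) -[j]/(val (Ordinal jr)) !extend_natE.
  by move=> /val_inj /perm_inj ->.
- by move=> jr ij; move: jr; rewrite -extend_nat_lt -ij extend_nat_lt ir.
- by move=> ir ij; move: ir; rewrite -extend_nat_lt ij extend_nat_lt jr.
- by move=> jr ir; rewrite /extend_nat !insubN.
Qed.

Lemma extend_nat_ltN (i : 'I_N) : (extend_nat i < N)%N.
Proof.
have [ir|ir] := boolP (i < r)%N.
  by apply: leq_trans rN; rewrite extend_nat_lt.
by rewrite /extend_nat insubN.
Qed.

Lemma extend_ord_inj : injective (fun i : 'I_N => Ordinal (extend_nat_ltN i)).
Proof. by move=> i j /(congr1 val) /extend_nat_inj /val_inj. Qed.

Definition extend_perm : 'S_N := perm extend_ord_inj.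

Lemma extend_permE i : extend_perm i = extend_nat i :> nat.
Proof. by rewrite permE. Qed.

Lemma extend_perm_widen k : extend_perm (widen_ord rN k) = widen_ord rN (s k).
Proof. by apply: val_inj; rewrite /= extend_permE extend_natE. Qed.

End ExtendPermutation.

Section SingularValues.
Context {R : realType}.

Lemma perm_mx_orthogonal k (s : 'S_k) : orthogonal_mx (perm_mx s : 'M[R]_k).
Proof. by rewrite /orthogonal_mx tr_perm_mx -perm_mxM mulgV perm_mx1. Qed.

Lemma sign_diag_orthogonal k (e : 'I_k -> bool) :
  orthogonal_mx (diag_mx (\row_i (-1) ^+ e i) : 'M[R]_k).
Proof.
rewrite /orthogonal_mx tr_diag_mx mulmx_diag -diag_const_mx; congr diag_mx.
by apply/rowP => i; rewrite !mxE -expr2 sqrr_sign.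
Qed.

(** The permutation acts on both sides, while all signs go to the left factor; indices beyond the
    diagonal are fixed and get sign +1. *)
Lemma dg_signed_perm m n (s : 'S_(minn m n)) e : exists P Q,
  [/\ orthogonal_mx P, orthogonal_mx Q &
      forall a : 'rV[R]_(minn m n), dg (signed_perm s e a) = P *m dg a *m Q^T].
Proof.
pose sm := extend_perm (geq_minl m n) s; pose sn := extend_perm (geq_minr m n) s.
pose e' (i : 'I_m) := if insub (i : nat) is Some k then e k else false.
exists (diag_mx (\row_i (-1) ^+ e' i) *m perm_mx sm), (perm_mx sn); split.
- by apply: orthogonal_mul; [exact: sign_diag_orthogonal|exact: perm_mx_orthogonal].
- exact: perm_mx_orthogonal.
move=> a; rewrite tr_perm_mx -mulmxA -col_permE -mulmxA -row_permE.
set X := diag_mx _ *m _.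
have XE i j : X i j = (-1) ^+ e' i * dg a (sm i) (sn j).
  by rewrite /X mul_diag_mx !mxE.
rewrite -[RHS]DgK; last first.
  move=> i j ij; rewrite XE dgE0 ?mulr0 // !extend_permE.
  by apply: contra_neq ij; exact: extend_nat_inj.
congr dg; apply/rowP => k;
    rewrite [LHS]mxE [RHS]mxE XE /sm /sn !extend_perm_widen dgEdiag.
by rewrite /e' /= valK.
Qed.

Lemma gram_dg m n (a : 'rV[R]_(minn m n)) : (dg a)^T *m dg a =
  diag_mx (\row_j (if insub (j : nat) is Some k then a 0 k ^+ 2 else 0)).
Proof.
apply/matrixP => i j; rewrite !mxE.
case: insubP => [k kr ki|ir]; last first.
  rewrite mul0rn big1 // => l _; rewrite mxE [dg a l i]dgE0 ?mul0r //.
  by apply: contraNneq ir => li; rewrite leq_min ltn_ord andbT -li ltn_ord.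
have -> : i = widen_ord (geq_minr m n) k by apply: val_inj.
rewrite (bigD1 (widen_ord (geq_minl m n) k)) //= mxE dgEdiag big1 ?addr0 => [|l lk].
  have [<-|jk] := eqVneq _ j; first by rewrite dgEdiag expr2 mulr1n.
  by rewrite dgE0 ?mulr0 //=; apply: contra_neq jk => kj; exact: val_inj.
by rewrite mxE dgE0 ?mul0r.
Qed.

(** The characteristic polynomial is the product of the 'X - d_j, so both lists contain each x as
    often as its multiplicity as a root. *)
Lemma eigenvalues_diag n (Q : 'M[R]_n) (d : 'rV[R]_n) : orthogonal_mx Q ->
  perm_eq (eigenvalues (Q *m diag_mx d *m Q^T)) [seq d 0 j | j : 'I_n].
Proof.
move=> Qo; rewrite /eigenvalues perm_sort; set p := char_poly _.
have pE : p = \prod_(x <- [seq d 0 j | j : 'I_n]) ('X - x%:P).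
  rewrite big_image /=.
  have -> : p = char_poly (diag_mx d).
    have up : map_mx polyC Q *m map_mx polyC Q^T = 1%:M :> 'M[{poly R}]_n.
      by rewrite -map_mxM Qo map_mx1.
    have -> : p = \det (map_mx polyC Q *m char_poly_mx (diag_mx d) *m map_mx
        polyC Q^T).
      rewrite /p /char_poly /char_poly_mx; congr (\det _).
      rewrite mulmxBr mulmxBl !map_mxM; congr (_ - _).
      by rewrite scalar_mxC -mulmxA up mulmx1.
    rewrite !det_mulmx mulrC mulrA -det_mulmx (mulmx1C up) det1 mul1r //.
  rewrite char_poly_trig; last exact: diag_mx_is_trig.
  by apply: eq_bigr => i _; rewrite mxE eqxx mulr1n.
have p0 : p != 0 by exact: monic_neq0 (char_poly_monic _).
apply/allP => x _ /=; apply/eqP.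
rewrite -[RHS]/(count_mem x _) -[RHS]mu_prod_XsubC -pE.
rewrite count_flatten -map_comp sumnE big_map.
under eq_bigr => y _ do rewrite /= count_nseq.
have [xp|xp] := boolP (x \in rootsR p).
  rewrite (bigD1_seq x) ?uniq_roots //= eqxx mul1n big1 ?addn0 // => y /negPf.
  by move=> ->.
rewrite big_seq big1 => [|y yp].
  rewrite mupNroot //; apply: contra xp => xp.
  by rewrite -roots_on_rootsR // inE /= in_itv.
have [yx|yx] := eqVneq y x; first by move: xp; rewrite -yx yp.
by rewrite /= (negPf yx).
Qed.

Lemma singular_values_nonincreasing_dg m n (P : 'M[R]_m) (Q : 'M[R]_n)
    (a : 'rV[R]_(minn m n)) :
  orthogonal_mx P -> orthogonal_mx Q -> nonincreasing_row a ->
  singular_values (P *m dg a *m Q^T) = a.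
Proof.
move=> Po Qo [a_mono a_ge0]; apply/rowP => k; rewrite mxE.
pose d : 'rV[R]_n := \row_j (if insub (j : nat) is Some k then a 0 k ^+ 2 else 0).
have gram : (P *m dg a *m Q^T)^T *m (P *m dg a *m Q^T) = Q *m diag_mx d *m Q^T.
  rewrite !trmx_mul trmxK !mulmxA -[Q *m _ *m P^T *m P]mulmxA orthogonal_mxC //.
  by rewrite mulmx1 -[Q *m _ *m dg a]mulmxA gram_dg.
have nth_d (j : 'I_n) : nth 0 [seq d 0 j | j : 'I_n] j = d 0 j.
  by rewrite (nth_map j) ?size_enum_ord // nth_ord_enum.
(* The entries of index at least [minn m n] are 0, so they close the list of squares without
   breaking its order; two sorted permutations of each other are equal. *)
have d_sorted : sorted >=%R [seq d 0 j | j : 'I_n].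
  apply/(sortedP 0) => i; rewrite size_map size_enum_ord => i1n.
  have iE := nth_d (Ordinal (ltnW i1n)); have i1E := nth_d (Ordinal i1n).
  rewrite /= in iE i1E; rewrite iE i1E !mxE /=.
  case: insubP => [k1 k1r k1E|_]; last by case: insubP => // *; exact: sqr_ge0.
  case: insubP => [k0 k0r k0E|]; last by rewrite (ltnW k1r).
  by rewrite ler_sqr ?nnegrE // a_mono // k0E k1E.
have -> : eigenvalues ((P *m dg a *m Q^T)^T *m (P *m dg a *m Q^T)) =
    [seq d 0 j | j : 'I_n].
  apply: (sorted_eq ge_trans ge_anti) => //.
    by apply: sort_sorted; exact: ge_total.
  by rewrite gram; exact: eigenvalues_diag.
have -> := nth_d (widen_ord (geq_minr m n) k).
by rewrite mxE /= valK sqrtr_sqr ger0_norm.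
Qed.

(** The signed permutation sorting a is absorbed by the orthogonal factors. The same factors serve
    every b, so a point and the gradient at it can be moved together. *)
Lemma exists_sorting_dg m n (P : 'M[R]_m) (Q : 'M[R]_n) (a : 'rV[R]_(minn m n)) :
  orthogonal_mx P -> orthogonal_mx Q -> exists P' Q' s e,
  [/\ orthogonal_mx P', orthogonal_mx Q', nonincreasing_row (signed_perm s e a) &
    forall b, P *m dg b *m Q^T = P' *m dg (signed_perm s e b) *m Q'^T].
Proof.
move=> Po Qo; have [s [e sorted_a]] := exists_sorting a.
have [s' [e' [spK _]]] := @signed_permV R _ s e.
have [P1 [Q1 [P1o Q1o dgE]]] := dg_signed_perm s' e'.
exists (P *m P1), (Q *m Q1), s, e; split=> //; try exact: orthogonal_mul.
by move=> b; rewrite -[in LHS](spK b) dgE trmx_mul !mulmxA.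
Qed.

Lemma exists_svd m n (U : 'M[R]_(m, n)) :
  exists P Q, [/\ orthogonal_mx P, orthogonal_mx Q,
    nonincreasing_row (singular_values U) &
    U = P *m dg (singular_values U) *m Q^T].
Proof.
have [P [Q [Po Qo diag]]] := exists_diagonalizing U.
have UE : U = P *m dg (Dg (P^T *m U *m Q)) *m Q^T.
  by rewrite DgK // !mulmxA Po mul1mx -mulmxA Qo mulmx1.
have [P' [Q' [s [e [P'o Q'o sorted_a E]]]]] :=
  exists_sorting_dg (Dg (P^T *m U *m Q)) Po Qo.
have sE : singular_values U = signed_perm s e (Dg (P^T *m U *m Q)).
  by rewrite [in LHS]UE E singular_values_nonincreasing_dg.
by exists P', Q'; rewrite sE -E -UE.
Qed.

Lemma singular_values_dg m n (P : 'M[R]_m) (Q : 'M[R]_n)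
    (a : 'rV[R]_(minn m n)) : orthogonal_mx P -> orthogonal_mx Q ->
  exists s e, singular_values (P *m dg a *m Q^T) = signed_perm s e a.
Proof.
move=> Po Qo; have [P' [Q' [s [e [P'o Q'o sorted_a ->]]]]] := exists_sorting_dg a
    Po Qo.
by exists s, e; exact: singular_values_nonincreasing_dg.
Qed.

Lemma fnorm_singular_values m n (U : 'M[R]_(m, n)) :
  fnorm (singular_values U) = fnorm U.
Proof.
have [P [Q [Po Qo _ UE]]] := exists_svd U.
by rewrite [in RHS]UE fnorm_orthogonal // fnorm_dg.
Qed.

End SingularValues.

(** * Von Neumann's trace inequality *)

Section VonNeumann.
Context {R : realType}.

Lemma doubly_substochastic_rearrangement r (a b : 'rV[R]_r)
    (D : 'I_r -> 'I_r -> R) :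
  nonincreasing_row a -> nonincreasing_row b ->
  (forall i j, 0 <= D i j) ->
  (forall i, \sum_j D i j <= 1) -> (forall j, \sum_i D i j <= 1) ->
  \sum_i \sum_j a 0 i * b 0 j * D i j <= inner a b.
Proof.
move=> [a_mono a0] [b_mono b0] D0 Drow Dcol.
(* Extension by 0 to all of [nat]: the value 0 at r is the boundary term of the telescoping sums. *)
pose ext (c : 'rV[R]_r) l := if insub l is Some k then c 0 k else 0.
have extE (c : 'rV[R]_r) (k : 'I_r) : ext c k = c 0 k by rewrite /ext valK.
have ext_ge0 c : nonincreasing_row c -> forall l, 0 <= ext c l.
  by move=> [_ c0] l; rewrite /ext; case: insubP.
have ext_mono c : nonincreasing_row c ->
    forall k l, (k <= l)%N -> ext c l <= ext c k.
  move=> [c_mono c0] k l kl; rewrite /ext.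
  case: insubP => [l' lr lE|_]; last by case: insubP.
  case: insubP => [k' kr kE|]; last by rewrite (leq_ltn_trans kl lr).
  by apply: c_mono; rewrite lE kE.
have := ext_mono a (conj a_mono a0); have := ext_mono b (conj b_mono b0).
have := ext_ge0 a (conj a_mono a0); have := ext_ge0 b (conj b_mono b0).
have : ext a r = 0 by rewrite /ext insubN // ltnn.
move: (ext a) (ext b) (extE a) (extE b) => A B AE BE Ar B_ge0 A_ge0 B_mono A_mono.
(* Dual certificate: u_i + v_j dominates a_i b_j, with equality for i = j. *)
pose u i := \sum_(i <= l < r) (A l - A l.+1) * B l.
pose v j := \sum_(j <= l < r) A l.+1 * (B l - B l.+1).
have u_ge0 i : 0 <= u i.
  by apply: sumr_ge0 => l _; rewrite mulr_ge0 // subr_ge0 A_mono.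
have v_ge0 i : 0 <= v i.
  by apply: sumr_ge0 => l _; rewrite mulr_ge0 // subr_ge0 B_mono.
have uv i : (i <= r)%N -> u i + v i = A i * B i.
  move=> ir; rewrite /u /v -big_split /=.
  rewrite (@telescope_sumr_eq _ _ _ (fun l => - (A l * B l))) // => [|l _].
    by rewrite Ar mul0r; ring.
  by ring.
have u_split i j : (i <= j <= r)%N -> u i =
      \sum_(i <= l < j) (A l - A l.+1) * B l + u j.
  by move=> /andP[ij jr]; rewrite /u (big_cat_nat ij jr).
have v_split i j : (i <= j <= r)%N -> v i =
      \sum_(i <= l < j) A l.+1 * (B l - B l.+1) + v j.
  by move=> /andP[ij jr]; rewrite /v (big_cat_nat ij jr).
(* For i <= j, u_i + v_j is A_j B_j plus the terms (A_l - A_(l+1)) B_l with i <= l < j; there B_l >=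
   B_j, so the sum is at least (A_i - A_j) B_j. The other case is symmetric. *)
have dual i j : (i < r)%N -> (j < r)%N -> A i * B j <= u i + v j.
  move=> ir jr; have [ij|/ltnW ji] := leqP i j.
    rewrite (u_split i j) ?ij ?(ltnW jr) // -addrA uv ?(ltnW jr) //.
    have : \sum_(i <= l < j) (A l - A l.+1) * B j <=
      \sum_(i <= l < j) (A l - A l.+1) * B l.
      rewrite big_nat [leRHS]big_nat; apply: ler_sum => l /andP[_ lj].
      by rewrite ler_wpM2l // ?subr_ge0 ?A_mono // B_mono // ltnW.
    rewrite -mulr_suml (@telescope_sumr_eq _ _ _ (fun l => - A l)) // => [|l _];
        last by ring.
    by lra.
  rewrite (v_split j i) ?ji ?(ltnW ir) // addrCA uv ?(ltnW ir) //.
  have : \sum_(j <= l < i) A i * (B l - B l.+1) <=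
      \sum_(j <= l < i) A l.+1 * (B l - B l.+1).
    rewrite big_nat [leRHS]big_nat; apply: ler_sum => l /andP[_ li].
    by rewrite ler_wpM2r // ?subr_ge0 ?B_mono // A_mono.
  rewrite -mulr_sumr (@telescope_sumr_eq _ _ _ (fun l => - B l)) // => [|l _];
      last by ring.
  by lra.
(* Weak duality: as u and v are nonnegative, row and column sums bounded by 1 leave at most the sum
   of u_i + v_i = a_i b_i. *)
apply: (@le_trans _ _ (\sum_(i < r) \sum_(j < r) (u i + v j) * D i j)).
  apply: ler_sum => i _; apply: ler_sum => j _.
  by rewrite ler_wpM2r // -AE -BE dual.
under eq_bigr => i _ do under eq_bigr => j _ do rewrite mulrDl.
under eq_bigr => i _ do rewrite big_split /=.
rewrite big_split /= [X in _ + X]exchange_big /= -big_split /=.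
rewrite innerE big_ord1; apply: ler_sum => i _.
rewrite -AE -BE -uv; last exact: ltnW.
by rewrite -!mulr_sumr lerD // ler_piMr.
Qed.

Lemma sum_widen_le p q (pq : (p <= q)%N) (F : 'I_q -> R) :
  (forall i, 0 <= F i) -> \sum_(k < p) F (widen_ord pq k) <= \sum_(i < q) F i.
Proof.
move=> F0; have inj : {in [set: 'I_p]%SET &, injective (widen_ord pq)}.
  by move=> i j _ _ /(congr1 val) /= /val_inj.
rewrite (eq_bigl (fun i => i \in [set: 'I_p]%SET)) => [|i]; last by rewrite inE.
rewrite -(big_imset _ inj) /= [leRHS](bigID (mem (widen_ord pq @: [set:
    'I_p]))%SET) /=.
by rewrite lerDl sumr_ge0.
Qed.

(** The inner product is a sum of a_k b_i P_ik Q_ik, and P_ik Q_ik <= (P_ik^2 + Q_ik^2) / 2. These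
    weights are only substochastic, because just the first [minn m n] rows and columns of P and Q
    enter. *)
Lemma inner_dg_le m n (P : 'M[R]_m) (Q : 'M[R]_n) (a b : 'rV[R]_(minn m n)) :
  orthogonal_mx P -> orthogonal_mx Q ->
  nonincreasing_row a -> nonincreasing_row b ->
  inner (P *m dg a *m Q^T) (dg b) <= inner a b.
Proof.
move=> Po Qo sa sb.
pose wm := widen_ord (geq_minl m n); pose wn := widen_ord (geq_minr m n).
pose D k i := (P (wm i) (wm k) ^+ 2 + Q (wn i) (wn k) ^+ 2) / 2.
have rowsum p (S : 'M[R]_p) i : orthogonal_mx S -> \sum_j S i j ^+ 2 = 1.
  move=> /matrixP/(_ i i); rewrite !mxE eqxx -[true%:R]/(1 : R) => <-.
  by apply: eq_bigr => j _; rewrite mxE expr2.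
have colsum p (S : 'M[R]_p) j : orthogonal_mx S -> \sum_i S i j ^+ 2 = 1.
  move=> /orthogonal_trmx/rowsum-/(_ j) <-.
  by apply: eq_bigr => i _; rewrite mxE.
have half2 x y : x <= 1 -> y <= 1 -> (x + y) / 2 <= 1 :> R by lra.
apply: le_trans (@doubly_substochastic_rearrangement _ a b D sa sb _ _ _).
- rewrite innerC inner_dgl innerE big_ord1 exchange_big /=; apply: ler_sum => i _.
  have -> : Dg (P *m dg a *m Q^T) 0 i =
      \sum_k a 0 k * (P (wm i) (wm k) * Q (wn i) (wn k)).
    rewrite /dg mulmx_sumr mulmx_suml mxE summxE; apply: eq_bigr => k _.
    rewrite -scalemxAr -scalemxAl mxE; congr (_ * _).
    by rewrite -(mul_delta_mx (0 : 'I_1)) mulmxA -colE -mulmxA -rowE mxE big_ord1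
        !mxE.
  rewrite mulr_sumr; apply: ler_sum => k _.
  rewrite mulrCA -mulrA ler_wpM2l ?(proj2 sa) // ler_wpM2l ?(proj2 sb) //.
  by rewrite /D; have := sqr_ge0 (P (wm i) (wm k) - Q (wn i) (wn k)); lra.
- by move=> i j; rewrite divr_ge0 // addr_ge0 // sqr_ge0.
- move=> k; rewrite -mulr_suml big_split /=; apply: half2.
    rewrite -(colsum _ P (wm k) Po).
    by apply: (sum_widen_le _ (F := fun i => P i (wm k) ^+ 2)) => i; exact: sqr_ge0.
  rewrite -(colsum _ Q (wn k) Qo).
  by apply: (sum_widen_le _ (F := fun i => Q i (wn k) ^+ 2)) => i; exact: sqr_ge0.
- move=> i; rewrite -mulr_suml big_split /=; apply: half2.
    rewrite -(rowsum _ P (wm i) Po).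
    by apply: (sum_widen_le _ (F := fun k => P (wm i) k ^+ 2)) => k; exact: sqr_ge0.
  rewrite -(rowsum _ Q (wn i) Qo).
  by apply: (sum_widen_le _ (F := fun k => Q (wn i) k ^+ 2)) => k; exact: sqr_ge0.
Qed.

Lemma von_neumann m n (P : 'M[R]_m) (Q : 'M[R]_n) (s : 'rV[R]_(minn m n))
    (U : 'M[R]_(m, n)) :
  orthogonal_mx P -> orthogonal_mx Q -> nonincreasing_row s ->
  inner (P *m dg s *m Q^T) U <= inner s (singular_values U).
Proof.
move=> Po Qo s_sorted; have [P' [Q' [P'o Q'o sU UE]]] := exists_svd U.
rewrite [in leLHS]UE innerC inner_mulmx innerC;
    move: (singular_values U) sU => a sa.
have -> : P'^T *m (P *m dg s *m Q^T) *m Q' = (P'^T *m P) *m dg s *m (Q'^T *m Q)^T.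
  by rewrite trmx_mul trmxK !mulmxA.
by apply: inner_dg_le => //; apply: orthogonal_mul => //; exact: orthogonal_trmx.
Qed.

(** For an unsorted s: sort it inside P and Q, then undo the signed permutation on the side of
    sigma(U). *)
Lemma von_neumann_signed_perm m n (P : 'M[R]_m) (Q : 'M[R]_n)
    (s : 'rV[R]_(minn m n)) (U : 'M[R]_(m, n)) :
  orthogonal_mx P -> orthogonal_mx Q ->
  exists p e, inner (P *m dg s *m Q^T) U <=
    inner s (signed_perm p e (singular_values U)).
Proof.
move=> Po Qo.
have [P' [Q' [p [e [P'o Q'o sorted_s ->]]]]] := exists_sorting_dg s Po Qo.
have [p' [e' [spK _]]] := @signed_permV R _ p e.
exists p', e'; rewrite -[X in inner X (signed_perm p' _ _)]spK inner_signed_perm.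
exact: von_neumann.
Qed.

End VonNeumann.

(** * Gradients of spectral functions *)

Section Gradient.
Context {R : realType} {p q : nat}.
Local Notation Z := 'M[R]_(p, q).
Implicit Types (f : Z -> R) (x g : Z).

(** Fréchet differentiability measured by [fnorm], in the quantified form that von Neumann's
    inequality delivers for f o sigma; [has_gradientE] then evaluates [grad]. *)
Definition has_gradient f x g := forall e, 0 < e -> exists2 d, 0 < d &
  forall u, fnorm (u - x) < d ->
    `|f u - f x - inner g (u - x)| <= e * fnorm (u - x).

Lemma inner_delta g i j : inner g (delta_mx i j) = g i j.
Proof.
rewrite innerE (bigD1 i) //= (bigD1 j) //= !big1 ?addr0.
- by rewrite mxE !eqxx mulr1.
- by move=> k ki; apply: big1 => l _; rewrite mxE (negPf ki) mulr0.
- by move=> k kj; rewrite mxE (negPf kj) andbF mulr0.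
Qed.

Lemma fnorm_delta i j : fnorm (delta_mx i j : Z) = 1.
Proof. by rewrite /fnorm inner_delta mxE !eqxx sqrtr1. Qed.

Lemma has_gradientE f x g : has_gradient f x g -> grad f x = g.
Proof.
move=> fg; apply/matrixP => i j; rewrite mxE -inner_delta /derive.
set v := delta_mx i j; apply/cvg_lim => //; apply/cvgrPdist_le => e e0.
have [d d0 fd] := fg e e0.
near=> h.
have h0 : h != 0 by near: h; exact: nbhs_dnbhs_neq.
have hd : `|h| < d.
  near: h; apply: dnbhs0_lt; exact: d0.
have := fd (h *: v + x); rewrite addrK fnormZ fnorm_delta mulr1 => /(_ hd).
rewrite innerZr => H.
rewrite distrC -(ler_pM2l (_ : 0 < `|h|)) ?normr_gt0 // -normrM.
rewrite [h * _]mulrBr /= -[h^-1 *: _]/(h^-1 * _) mulrA divff // mul1r.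
by rewrite [leRHS]mulrC.
Unshelve. all: by end_near. Qed.

Lemma differentiable_has_gradient f x :
  differentiable f x -> has_gradient f x (grad f x).
Proof.
move=> df e e0.
have dE h : 'd f x h = inner (grad f x) h.
  rewrite [h in LHS]matrix_sum_delta innerE linear_sum; apply: eq_bigr => i _.
  rewrite linear_sum; apply: eq_bigr => j _.
  by rewrite linearZ /= -deriveE // mxE mulrC.
have := diff_locally df => /eqaddoP /(_ e e0).
rewrite nearE /= => /nbhs_ballP [d /= d0 H]; exists d => // u ud.
have := H (u - x); rewrite -ball_normE /= sub0r normrN.
move=> /(_ (le_lt_trans (mx_norm_le_fnorm _) ud)).
rewrite /= !fctE /= subrK dE opprD addrA => h.
by apply: le_trans h _; rewrite ler_wpM2l ?mx_norm_le_fnorm // ltW.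
Qed.

(** The smooth parts on vectors and on matrices both have this form, with f2V and f2V o sigma for
    f. *)
Lemma has_gradient_quadratic f x g (k l : R) c (psi : Z -> R) :
  has_gradient f x g ->
  (forall u, psi u = k + l * f u + inner c u + 2^-1 * fnorm u ^+ 2) ->
  has_gradient psi x (l *: g + c + x).
Proof.
move=> fg psiE e e0.
have l1 : 0 < `|l| + 1 by rewrite ltr_wpDl.
(* Half of e pays for l f, the other half for the quadratic remainder; the + 1 covers l = 0. *)
have e'0 : 0 < e / 2 / (`|l| + 1) by rewrite !divr_gt0.
have [d d0 fd] := fg _ e'0.
exists (Num.min d e); first by rewrite lt_min d0.
move=> u; rewrite lt_min => /andP[ud ue].
have -> : psi u - psi x - inner (l *: g + c + x) (u - x) =
    l * (f u - f x - inner g (u - x)) + 2^-1 * fnorm (u - x) ^+ 2.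
  by rewrite !psiE !fnorm2 !innerlin [inner u x]innerC; field.
apply: le_trans (ler_normD _ _) _.
rewrite normrM [`|2^-1 * _|]ger0_norm; last by rewrite mulr_ge0 ?sqr_ge0.
have D0 := fnorm_ge0 (u - x); have := fd _ ud.
set A := `|f u - _ - _|; set D := fnorm (u - x) in D0 ue *.
move=> hA; have : `|l| * A <= e / 2 * D.
  apply: le_trans (_ : (`|l| + 1) * A <= _).
    by rewrite ler_wpM2r ?lerDl ?normr_ge0.
  rewrite -ler_pdivlMl //; apply: le_trans hA _.
  by rewrite [leRHS]mulrA [_^-1 * _]mulrC.
by move: D0 ue; nra.
Qed.

End Gradient.

Section SpectralGradient.
Context {R : realType} {r : nat}.
Implicit Types (y g : 'rV[R]_r).

Lemma has_gradient_signed_perm (f : 'rV[R]_r -> R) y g s e :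
  absolutely_symmetric f -> has_gradient f y g ->
  has_gradient f (signed_perm s e y) (signed_perm s e g).
Proof.
move=> fsym fg eps eps0; have [d d0 fd] := fg _ eps0; exists d => // u.
have [s' [e' [_ spK]]] := @signed_permV R _ s e.
rewrite -(spK u); move: (signed_perm s' e' u) => {}u;
    rewrite -linearB /= fnorm_signed_perm inner_signed_perm.
by rewrite !(absolutely_symmetric_signed_perm _ _ _ fsym); exact: fd.
Qed.

(** Gradients are equivariant and unique, so a symmetry fixing y also fixes the gradient at y. *)
Lemma grad_signed_perm_fixed (f : 'rV[R]_r -> R) y s e :
  absolutely_symmetric f -> differentiable f y ->
  signed_perm s e y = y -> signed_perm s e (grad f y) = grad f y.
Proof.
move=> fsym /differentiable_has_gradient fy yE.
have := has_gradient_signed_perm s e fsym fy; rewrite yE => /has_gradientE.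
by [].
Qed.

Lemma exists_small_step (I : finType) (P : pred I) (A B : I -> R) :
  (forall i, P i -> 0 < A i) ->
  exists2 d, 0 < d & forall i, P i -> d * `|B i| <= A i.
Proof.
move=> A0; exists (\big[Num.min/1]_(i | P i) (A i / (`|B i| + 1))).
  apply: lt_bigmin => // i Pi; rewrite divr_gt0 ?A0 // ltr_wpDl //.
move=> i Pi; have B1 : 0 < `|B i| + 1 by rewrite ltr_wpDl.
apply: le_trans (_ : A i / (`|B i| + 1) * `|B i| <= _).
  by rewrite ler_wpM2r // bigmin_le_cond.
rewrite mulrAC ler_pdivrMr //.
by rewrite ler_wpM2l ?lerDl // ltW // A0.
Qed.

(* By symmetry grad f y is constant on ties of y and zero where y is, so small
   multiples of it of either sign do not disturb the order of y. *)
Lemma nonincreasing_row_grad (f : 'rV[R]_r -> R) y :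
  absolutely_symmetric f -> differentiable f y -> nonincreasing_row y ->
  exists2 d, 0 < d & nonincreasing_row (y + d *: grad f y) /\
    nonincreasing_row (y - d *: grad f y).
Proof.
move=> fsym fy [y_mono y0]; set g := grad f y.
have g_eq i j : y 0 i = y 0 j -> g 0 i = g 0 j.
  move=> yij; have /matrixP/(_ 0 j) :
      signed_perm (tperm i j) (fun=> false) g = g.
    apply: grad_signed_perm_fixed => //; apply/rowP => k; rewrite mxE mul1r.
    by case: tpermP => // ->.
  by rewrite mxE mul1r tpermR.
have g_eq0 i : y 0 i = 0 -> g 0 i = 0.
  move=> yi; have /matrixP/(_ 0 i) :
      signed_perm 1%g (fun k => k == i) g = g.
    apply: grad_signed_perm_fixed => //; apply/rowP => k; rewrite mxE perm1.
    by case: eqP => [->|_]; rewrite ?yi ?mulr0 ?mul1r.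
  by rewrite mxE perm1 eqxx mulN1r => h; move: h; lra.
clearbody g.
have [d1 d1_gt0 d1P] := @exists_small_step ('I_r * 'I_r)%type
  (fun ij => y 0 ij.2 < y 0 ij.1) (fun ij => y 0 ij.1 - y 0 ij.2)
  (fun ij => g 0 ij.1 - g 0 ij.2) (fun ij h => etrans (subr_gt0 _ _) h).
have [d2 d2_gt0 d2P] := @exists_small_step _ (fun i => 0 < y 0 i) (y 0) (g 0)
  (fun i h => h).
have shift k : `|k| <= Num.min d1 d2 -> nonincreasing_row (y + k *: g).
  rewrite le_min => /andP[k1 k2]; split=> [i j ij|i]; rewrite !mxE.
    have [yij|] := eqVneq (y 0 j) (y 0 i); first by rewrite yij (g_eq _ _ yij).
    move=> ne; have yij : y 0 j < y 0 i by rewrite lt_neqAle ne y_mono.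
    have /= := d1P (i, j) yij => h.
    have : k * (g 0 j - g 0 i) <= d1 * `|g 0 i - g 0 j|.
      apply: le_trans (ler_norm _) _; rewrite normrM distrC.
      by rewrite ler_wpM2r.
    by lra.
  have := y0 i; rewrite le_eqVlt => /orP[/eqP yi|yi].
    by rewrite -yi (g_eq0 i) // mulr0 addr0.
  have := d2P i yi => h.
  have : - (k * g 0 i) <= d2 * `|g 0 i|.
    apply: le_trans (ler_norm _) _; rewrite normrN normrM.
    by rewrite ler_wpM2r.
  by lra.
have d0 : 0 < Num.min d1 d2 by rewrite lt_min d1_gt0.
exists (Num.min d1 d2) => //; rewrite -scaleNr.
by split; apply: shift; rewrite ?normrN gtr0_norm.
Qed.

End SpectralGradient.

Section SpectralDifferentiability.
Context {R : realType} {m n : nat}.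
Local Notation sigma := (@singular_values R m n).
Implicit Types (f : 'rV[R]_(minn m n) -> R) (y : 'rV[R]_(minn m n)).

(* Von Neumann's inequality for y + d g and for y - d g bounds
   d |<g, sigma(U) - y> - <G, U - Y>| by <y, sigma(U)> - <Y, U>, which is at most
   |U - Y|^2 / 2 because sigma preserves the norm. *)
Lemma has_gradient_spectral_sorted f y (P : 'M[R]_m) (Q : 'M[R]_n) :
  orthogonal_mx P -> orthogonal_mx Q ->
  absolutely_symmetric f -> differentiable f y -> nonincreasing_row y ->
  has_gradient (fun U => f (sigma U)) (P *m dg y *m Q^T)
    (P *m dg (grad f y) *m Q^T).
Proof.
move=> Po Qo fsym fy y_sorted e e0; set g := grad f y.
have [d d0 [sp sm]] := nonincreasing_row_grad fsym fy y_sorted.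
rewrite -/g in sp sm.
have [d' d'0 fd] := differentiable_has_gradient fy (divr_gt0 e0 (ltr0n R 2)).
set Y := P *m dg y *m Q^T; set G := P *m dg g *m Q^T.
have sY : sigma Y = y by exact: singular_values_nonincreasing_dg.
(* The radius e d turns the quadratic gap bound |U - Y|^2 / (2 d) into e / 2 |U - Y|. *)
exists (Num.min d' (e * d)); first by rewrite lt_min d'0 mulr_gt0.
move=> U; rewrite lt_min => /andP[Ud' Ued].
have vp := von_neumann U Po Qo sp; have vm := von_neumann U Po Qo sm.
have vy := von_neumann U Po Qo y_sorted.
have dgE k : P *m dg (y + k *: g) *m Q^T = Y + k *: G.
  by rewrite linearD linearZ /= mulmxDr mulmxDl -scalemxAr -scalemxAl.
rewrite -scaleNr in vm; rewrite !dgE !innerlin in vp vm; rewrite -/Y in vy.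
have YY : inner Y Y = inner y y by rewrite inner_orthogonal // inner_dg.
have GY : inner G Y = inner g y by rewrite inner_orthogonal // inner_dg.
have UU : inner U U = inner (sigma U) (sigma U).
  by rewrite -!fnorm2 fnorm_singular_values.
have contraction : fnorm (sigma U - y) <= fnorm (U - Y).
  rewrite -(@ler_pXn2r _ 2) ?nnegrE ?fnorm_ge0 // !fnorm2 !innerlin.
  by rewrite [inner (sigma U) y]innerC [inner U Y]innerC YY UU; lra.
have := fd (sigma U) (le_lt_trans contraction Ud').
have gap : `|inner g (sigma U - y) - inner G (U - Y)| <= e / 2 * fnorm (U - Y).
  have : d * `|inner g (sigma U - y) - inner G (U - Y)| <=
      2^-1 * fnorm (U - Y) ^+ 2.
    rewrite -[d in leLHS]gtr0_norm // -normrM ler_norml.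
    rewrite fnorm2 !innerlin [inner U Y]innerC YY UU GY.
    have := inner_ge0 (sigma U - y); rewrite !innerlin [inner (sigma U) y]innerC.
    by move: vp vm vy => vp vm vy h; apply/andP; split; lra.
  have := fnorm_ge0 (U - Y); move: Ued; set D := fnorm _; set B := `|_|.
  move=> Ded D0 h; rewrite -(ler_pM2l d0); apply: le_trans h _.
  by nra.
rewrite sY => h; have -> : f (sigma U) - f y - inner G (U - Y) =
  (f (sigma U) - f y - inner g (sigma U - y)) +
  (inner g (sigma U - y) - inner G (U - Y)) by ring.
apply: le_trans (ler_normD _ _) _.
apply: le_trans (lerD h gap) _.
have : e / 2 * fnorm (sigma U - y) <= e / 2 * fnorm (U - Y).
  by rewrite ler_wpM2l // ltW // divr_gt0.
by lra.
Qed.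

Lemma has_gradient_spectral f y (P : 'M[R]_m) (Q : 'M[R]_n) :
  orthogonal_mx P -> orthogonal_mx Q ->
  absolutely_symmetric f -> (forall x, differentiable f x) ->
  has_gradient (fun U => f (sigma U)) (P *m dg y *m Q^T)
    (P *m dg (grad f y) *m Q^T).
Proof.
move=> Po Qo fsym df.
have [P' [Q' [s [e [P'o Q'o y_sorted E]]]]] := exists_sorting_dg y Po Qo.
rewrite !E.
have /has_gradientE <- := has_gradient_signed_perm s e fsym
  (differentiable_has_gradient (df y)).
exact: has_gradient_spectral_sorted.
Qed.

End SpectralDifferentiability.

(** * Strongly convex minimization *)

Section Argmin.
Context {R : realType} {p q : nat}.
Local Notation Z := 'M[R]_(p, q).
Implicit Types (g : Z -> \bar R) (Q : Z -> R) (x c : Z).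

(* The gradient of Q at x is c + M x and its Hessian is M times the identity. *)
Definition quadratic (M : R) c Q :=
  forall x u, Q u = Q x + inner (c + M *: x) (u - x) + M / 2 * fnorm (u - x) ^+ 2.

Lemma quadratic_proximal M c y :
  quadratic M (c - M *: y) (fun u => inner c u + M / 2 * fnorm (u - y) ^+ 2).
Proof.
move=> x u; rewrite !fnorm2 !innerlin.
by rewrite [inner y u]innerC [inner y x]innerC [inner x u]innerC; field.
Qed.

Lemma linearization_quadratic Q M y :
  quadratic M (grad Q y - M *: y)
    (fun u => linearization Q y u + M / 2 * fnorm (u - y) ^+ 2).
Proof.
move=> x u; rewrite /linearization !fnorm2 !innerlin.
by rewrite [inner y u]innerC [inner y x]innerC [inner x u]innerC; field.
Qed.

(** Letting t tend to 0, in the form used for first-order optimality. *)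
Lemma ge0_limit0 (L K : R) :
  (forall t, 0 < t <= 1 -> 0 <= L + t * K) -> 0 <= L.
Proof.
move=> h; rewrite leNgt; apply/negP => L0.
have K1 : 0 < 2 * (`|K| + 1) by rewrite mulr_gt0 // ltr_wpDl.
pose t := Num.min 1 (- L / (2 * (`|K| + 1))).
have t0 : 0 < t by rewrite lt_min ltr01 divr_gt0 // oppr_gt0.
have t1 : t <= 1 by rewrite ge_min lexx.
have := h t; rewrite t0 t1 => /(_ isT).
have : t * (2 * (`|K| + 1)) <= - L by rewrite -ler_pdivlMr // ge_min lexx orbT.
have : t * K <= t * `|K| by rewrite ler_wpM2l ?ler_norm // ltW.
by lra.
Qed.

Lemma argmin_fin_num g Q x :
  (forall u, -oo < g u)%E -> dom g !=set0 ->
  argmin (fun u => (Q u)%:E + g u)%E x -> g x \is a fin_num.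
Proof.
move=> gN [u gu] /(_ u) /= Fxu.
have {}gu : g u \is a fin_num by rewrite fin_real // gN.
rewrite fin_real // gN ltey; apply/eqP => gx.
by move: Fxu; rewrite gx addey // -(fineK gu) -EFinD leNgt ltry.
Qed.

(** Compare x with t u + (1 - t) x: convexity bounds the increment of g linearly in t, while the
    quadratic remainder of Q is of order t^2 and vanishes after division by t. *)
Lemma argmin_subgradient g M c Q x u :
  (forall u, -oo < g u)%E -> dom g !=set0 -> convex_efun g -> quadratic M c Q ->
  argmin (fun u => (Q u)%:E + g u)%E x ->
  (g x + (inner (- (c + M *: x)) (u - x))%:E <= g u)%E.
Proof.
move=> gN gp gconv QE xmin; have gx := argmin_fin_num gN gp xmin.
have [->|gu] := eqVneq (g u) +oo%E; first exact: leey.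
have {}gu : g u \is a fin_num by rewrite fin_real // gN ltey.
rewrite -(fineK gx) -(fineK gu) -EFinD lee_fin innerNl.
rewrite -subr_ge0.
apply: (@ge0_limit0 _ (M / 2 * fnorm (u - x) ^+ 2)) => t /andP[t0 t1].
rewrite -(pmulr_rge0 _ t0).
have t01 : 0 <= t <= 1 by rewrite ltW.
have := le_trans (xmin _) (leeD2l _ (gconv u x t t01)).
rewrite -(fineK gx) -(fineK gu) -!EFinM -!EFinD lee_fin (QE x (t *: u + _)).
have -> : t *: u + (1 - t) *: x - x = t *: (u - x).
  by rewrite scalerBl scale1r scalerBr addrA addrAC addrK.
rewrite fnormZ innerZr exprMn (ger0_norm (ltW t0)) /=.
by lra.
Qed.

Lemma argmin_growth g M c Q x u :
  (forall u, -oo < g u)%E -> dom g !=set0 -> convex_efun g -> quadratic M c Q ->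
  argmin (fun u => (Q u)%:E + g u)%E x ->
  ((Q x)%:E + g x + (M / 2 * fnorm (u - x) ^+ 2)%:E <= (Q u)%:E + g u)%E.
Proof.
move=> gN gp gconv QE xmin.
have := argmin_subgradient u gN gp gconv QE xmin.
have gx := argmin_fin_num gN gp xmin; rewrite -(fineK gx) => h.
apply: le_trans (leeD2l _ h).
by rewrite -!EFinD lee_fin (QE x u) innerNl; lra.
Qed.

Lemma growth_argmin (F : Z -> \bar R) (M : R) x : 0 < M -> F x \is a fin_num ->
  (forall u, F x + (M / 2 * fnorm (u - x) ^+ 2)%:E <= F u)%E ->
  argmin F = [set x].
Proof.
move=> M0 Fx growth; apply/seteqP; split=> [u /(_ x) Fux|_ -> u].
  have := le_trans (growth u) Fux; rewrite -(fineK Fx) -EFinD lee_fin gerDl.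
  rewrite pmulr_rle0 ?divr_gt0 // => ux.
  have : fnorm (u - x) ^+ 2 = 0 by apply/eqP; rewrite eq_le ux sqr_ge0.
  by move=> /eqP; rewrite sqrf_eq0 => /eqP/fnorm_eq0/eqP; rewrite subr_eq0 => /eqP.
apply: le_trans (growth u); rewrite leeDl // lee_fin mulr_ge0 ?sqr_ge0 //.
by rewrite ltW // divr_gt0.
Qed.

End Argmin.

(** * Existence of minimizers *)

Section ArgminExistence.
Context {R : realType}.

(** Without a minimizer the open sets {F > F w}, for w in K, cover K. In a finite subcover, a centre
    w with the least value F w is covered by none of them. *)
Lemma lower_semicontinuous_min (T : ptopologicalType) (K : set T)
    (F : T -> \bar R) :
  compact K -> K !=set0 -> lower_semicontinuous F -> (forall u, -oo < F u)%E ->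
  exists2 x, K x & forall u, K u -> (F x <= F u)%E.
Proof.
move=> Kc [k0 Kk0] Flsc FN; apply: contrapT => nomin.
have lower x : K x -> exists2 w, K w & (F w < F x)%E.
  move=> Kx; apply: contrapT => now; apply: nomin; exists x => // u Ku.
  by rewrite leNgt; apply/negP => Fux; apply: now; exists u.
have : cover_compact K by rewrite -compact_cover.
move=> /(_ T K (fun w => [set x | (F w < F x)%E])) [].
- move=> w Kw; case Fw : (F w) => [a| |].
  + by move/lower_semicontinuousP : Flsc; exact.
  + rewrite (_ : mkset _ = set0); first exact: open0.
    by apply/seteqP; split => // x /=; rewrite ltNge leey.
  + by have := FN w; rewrite Fw.
- by move=> x /lower[w Kw Fwx]; exists w.
move=> D DK Kcover.
have smin (s : seq T) w0 : w0 \in s ->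
    exists2 w, w \in s & forall u, u \in s -> (F w <= F u)%E.
  elim: s w0 => // a [|b s] IH w0 _.
    by exists a; rewrite ?mem_head // => u; rewrite inE => /eqP ->.
  have [w ws wmin] := IH b (mem_head _ _).
  have [Fwa|/ltW Faw] := leP (F w) (F a).
    exists w; first by rewrite inE ws orbT.
    by move=> u; rewrite inE => /orP[/eqP -> //|/wmin].
  exists a; first exact: mem_head.
  by move=> u; rewrite inE => /orP[/eqP -> //|/wmin]; exact: le_trans.
have [w1 w1D _] := Kcover _ Kk0.
have [w wD wmin] := smin (finmap.enum_fset D) w1 w1D.
have Kw : K w by exact: set_mem (DK _ wD).
have [w2 /= w2D] := Kcover _ Kw.
by rewrite ltNge wmin.
Qed.

Lemma compact_fnorm_ball n (rho : R) : compact [set v : 'rV[R]_n | fnorm v <= rho].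
Proof.
apply: bounded_closed_compact; first by apply: (@bounded_fnorm _ _ _ rho).
have [rho0|rho0] := ltP rho 0.
  rewrite (_ : mkset _ = set0); first exact: closed0.
  apply/seteqP; split => // v /= vrho.
  by have := le_lt_trans (le_trans (fnorm_ge0 v) vrho) rho0; rewrite ltxx.
rewrite (_ : mkset _ = (fun v : 'rV[R]_n => inner v v) @^-1` [set x | x <=
    rho ^+ 2]).
  apply: preimage_closed; last exact: closed_le.
  by move=> v _; exact: continuous_inner.
by apply/seteqP; split => v /=; rewrite -fnorm2 ler_pXn2r ?nnegrE ?fnorm_ge0.
Qed.

Lemma lower_semicontinuousD (T : topologicalType) (f : T -> R) (g : T -> \bar R) :
  continuous f -> lower_semicontinuous g ->
  lower_semicontinuous (fun u => ((f u)%:E + g u)%E).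
Proof.
move=> fc glsc x a axfg.
have [b [bg ab]] : exists b, (b%:E < g x)%E /\ a - b < f x.
  move: axfg; case: (g x) => [c| |] //=.
    rewrite -EFinD lte_fin => h; exists ((a - f x + c) / 2).
    by rewrite lte_fin; split; lra.
  by move=> _; exists (a - f x + 1); rewrite ltey; split => //; lra.
have [V Vx gV] := glsc x b bg.
have W : nbhs x (f @^-1` [set y | a - b < y]).
  by apply: fc; exact: (open_nbhs_nbhs (conj (@open_gt _ _) ab)).
exists (V `&` (f @^-1` [set y | a - b < y])); first exact: filterI.
move=> y [/gV bgy /= aby]; apply: lt_le_trans (leeD2l _ (ltW bgy)).
by rewrite -EFinD lte_fin -ltrBlDr.
Qed.

Lemma continuous_quadratic n (M : R) (c : 'rV[R]_n) Q :
  quadratic M c Q -> continuous Q.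
Proof.
move=> QE.
have -> : Q = (fun u => Q 0 + (\sum_i c 0 i * u 0 i) + M / 2 * inner u u).
  apply/funext => u; rewrite (QE 0 u) subr0 scaler0 addr0 fnorm2 innerE.
  by rewrite big_ord1.
have lin : continuous (fun u : 'rV[R]_n => \sum_i c 0 i * u 0 i).
  apply: continuous_big => [|i _]; first exact: add_continuous.
  by move=> v; apply: continuousM; [exact: cst_continuous|exact: coord_continuous].
have sq : continuous (fun u : 'rV[R]_n => M / 2 * inner u u).
  by move=> v; exact: (cvgM (cvg_cst _) (@continuous_inner _ _ v)).
move=> v; exact: (cvgD (cvgD (cvg_cst _) (lin v)) (sq v)).
Qed.

(** g may be unbounded below, but convexity propagates its minimum m over a ball to an affine lower
    bound in |u - x0|, which the quadratic dominates far away. This reduces the problem to a compact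
    ball. *)
Lemma exists_argmin n (g : 'rV[R]_n -> \bar R) (M : R) c Q :
  proper_lsc_convex g -> 0 < M -> quadratic M c Q ->
  exists x, argmin (fun u => (Q u)%:E + g u)%E = [set x].
Proof.
move=> [gN gp glsc gconv] M0 QE.
pose F u := ((Q u)%:E + g u)%E.
have Flsc : lower_semicontinuous F.
  exact: lower_semicontinuousD (continuous_quadratic QE) glsc.
have FN u : (-oo < F u)%E.
  by rewrite /F; case: (g u) (gN u) => // b _; rewrite -EFinD ltNyr.
have [x0 gx0] := gp.
have {}gx0 : g x0 \is a fin_num by rewrite fin_real // gN.
pose a := fine (g x0).
have [|w Kw wmin] := lower_semicontinuous_min
  (@compact_fnorm_ball n (fnorm x0 + 1)) _ glsc gN.
  by exists x0 => /=; rewrite lerDl.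
have gw : g w \is a fin_num.
  rewrite fin_real // gN (le_lt_trans (wmin x0 _)) //= ?lerDl //.
  by rewrite -(fineK gx0) ltry.
pose m := fine (g w); pose N := fnorm (c + M *: x0).
have am : m <= a by rewrite -lee_fin !fineK // wmin //= lerDl.
(* With d = |u - x0|, F u - F x0 >= d (M d / 2 - N - (a - m)), nonnegative beyond [rho]. The 1
   ensures d >= 1, so that the point at distance 1 from x0 towards u is a convex combination; it
   lies in the ball where m is the minimum. *)
pose rho := 1 + 2 * (N + a - m) / M.
have N0 : 0 <= N by exact: fnorm_ge0.
have rho1 : 1 <= rho by rewrite lerDl divr_ge0 ?(ltW M0) //; lra.
have far u : rho < fnorm (u - x0) -> (F x0 <= F u)%E.
  move=> urho; rewrite /F.
  have [->|gu] := eqVneq (g u) +oo%E; first by rewrite addey // leey.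
  have {}gu : g u \is a fin_num by rewrite fin_real // gN ltey.
  have d0 : 0 < fnorm (u - x0) by apply: lt_trans urho; lra.
  have d1 : (fnorm (u - x0))^-1 <=
      1 by rewrite invf_le1 // ltW // (le_lt_trans rho1).
  have t01 : 0 <= (fnorm (u - x0))^-1 <= 1 by rewrite invr_ge0 fnorm_ge0.
  have := le_trans (wmin _ _) (gconv u x0 _ t01) => /=.
  set z := _ *: u + _; have zK : fnorm z <= fnorm x0 + 1.
    have -> : z = x0 + (fnorm (u - x0))^-1 *: (u - x0).
      by rewrite /z scalerBl scale1r scalerBr addrCA.
    apply: le_trans (fnormD _ _) _;
        rewrite fnormZ ger0_norm ?invr_ge0 ?fnorm_ge0 //.
    by rewrite mulVf ?lt0r_neq0.
  move=> /(_ zK); rewrite -(fineK gx0) -(fineK gu) -(fineK gw) -!EFinM -!EFinD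
      !lee_fin /=.
  rewrite -/a -/m (QE x0 u); set b := fine (g u) => h.
  have {h} : fnorm (u - x0) * m <= b + (fnorm (u - x0) - 1) * a.
    rewrite -(ler_pM2l (_ : 0 < (fnorm (u - x0))^-1)) ?invr_gt0 //
        mulrDr !mulrA mulVf ?lt0r_neq0 //.
    rewrite mulrBr mulVf ?lt0r_neq0 // mulr1 mul1r //.
  have := normr_inner (c + M *: x0) (u - x0); rewrite -/N ler_norml => /andP[+ _].
  have : 2 * (N + a - m) <= M * (fnorm (u - x0) - 1).
    rewrite mulrC -ler_pdivrMl // mulrC. move: urho; rewrite /rho; lra.
  set d := fnorm _ in urho d0 *; nra.
have [|x Kx xmin] := lower_semicontinuous_min
  (@compact_fnorm_ball n (fnorm x0 + rho)) _ Flsc FN.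
  by exists x0 => /=; rewrite lerDl; lra.
have xargmin : argmin F x.
  move=> u; have [uK|] := leP (fnorm u) (fnorm x0 + rho); first exact: xmin.
  move=> uK; apply: (@le_trans _ _ (F x0)); first by apply: xmin => /=;
      rewrite lerDl; lra.
  apply: far; have := fnormD (u - x0) x0; rewrite subrK; lra.
exists x; apply: (growth_argmin M0).
  by rewrite fin_numD /= (argmin_fin_num gN gp xargmin).
by move=> u; exact: argmin_growth.
Qed.

End ArgminExistence.

(** * R-ACG *)

Section RACGAnalysis.
Context {R : realType} {p q : nat}.
Local Notation Z := 'M[R]_(p, q).
Context (mu M : R) (psi_s : Z -> R) (psi_n : Z -> \bar R) (z : nat -> Z).
Context (mu_ge0 : 0 <= mu) (mu_lt_M : mu < M).

Local Notation B := (racg_B mu M).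
Local Notation b := (racg_b mu M).
Local Notation zc := (racg_zc mu M z).
Local Notation zt := (racg_ztilde mu M z).
Local Notation psi := (composite psi_s psi_n).

Lemma racg_BS i : B i.+1 = B i + b i.
Proof. by []. Qed.

(** The equation, which defines the step as its positive root, completes a square in
    [racg_estimate]; the lower bound makes B_j grow at least linearly. *)
Lemma racg_step_props (C : R) : 0 <= C ->
  (M - mu)^-1 <= racg_step mu M C /\
  racg_step mu M C ^+ 2 * (M - mu) = (1 + mu * C) * (C + racg_step mu M C).
Proof.
move=> C0; rewrite /racg_step; set xi := (1 + mu * C) / (M - mu).
have Mm : 0 < M - mu by rewrite subr_gt0.
have xi0 : (M - mu)^-1 <= xi.
  by rewrite /xi -[leLHS]mul1r ler_pM2r ?invr_gt0 // lerDl mulr_ge0.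
have xi_gt0 : 0 < xi by apply: lt_le_trans xi0; rewrite invr_gt0.
have disc0 : 0 <= xi ^+ 2 + 4 * xi * C.
  by rewrite addr_ge0 ?sqr_ge0 // mulr_ge0 // mulr_ge0 // ltW.
have := sqr_sqrtr disc0; have := sqrtr_ge0 (xi ^+ 2 + 4 * xi * C).
have xiE : xi * (M - mu) = 1 + mu * C by rewrite /xi divfK // lt0r_neq0.
set s := Num.sqrt _ => s0 s2; split.
  apply: le_trans xi0 _.
  have : xi <= s.
    rewrite -(@ler_pXn2r _ 2) ?nnegrE ?(ltW xi_gt0) // s2 lerDl.
    by rewrite mulr_ge0 // mulr_ge0 // ltW.
  by lra.
by rewrite -xiE; nra.
Qed.

Lemma racg_B_ge0 i : 0 <= B i.
Proof.
elim: i => //= i IH; rewrite addr_ge0 //.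
apply: le_trans (racg_step_props IH).1; rewrite invr_ge0 subr_ge0.
exact: ltW.
Qed.

Lemma racg_b_gt0 i : 0 < b i.
Proof.
by apply: lt_le_trans (racg_step_props (racg_B_ge0 i)).1; rewrite invr_gt0 subr_gt0.
Qed.

Lemma racg_b2 i : b i ^+ 2 * (M - mu) = (1 + mu * B i) * B i.+1.
Proof. exact: (racg_step_props (racg_B_ge0 i)).2. Qed.

Lemma racg_BS_gt0 i : 0 < B i.+1.
Proof. by rewrite racg_BS ltr_wpDl ?racg_B_ge0 ?racg_b_gt0. Qed.

Lemma racg_B_gt0 j : (0 < j)%N -> 0 < B j.
Proof. by case: j => // j _; exact: racg_BS_gt0. Qed.

Lemma racg_B_linear i : i%:R / (M - mu) <= B i.
Proof.
elim: i => [|i IH]; first by rewrite mul0r.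
rewrite racg_BS -natr1 mulrDl mul1r lerD //.
exact: (racg_step_props (racg_B_ge0 i)).1.
Qed.

(** The second hypothesis says that the gradient of F vanishes at c', and the Hessian of F is al +
    be nu times the identity. It matches the update of z^c. *)
Lemma quadratic_min (k al be ka nu : R) (c c' w x u : Z) (F : Z -> R) :
  (forall u, F u = k + al / 2 * fnorm (u - c) ^+ 2 +
     be * (ka * inner w (u - x) + nu / 2 * fnorm (u - x) ^+ 2)) ->
  (al + be * nu) *: c' = al *: c - (be * ka) *: w + (be * nu) *: x ->
  F u = F c' + (al + be * nu) / 2 * fnorm (u - c') ^+ 2.
Proof.
move=> FE c'E; have := congr1 (fun v => inner v (u - c')) c'E.
rewrite !FE !fnorm2 !innerlin.
rewrite [inner c u]innerC [inner x u]innerC [inner c' u]innerC.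
rewrite [inner c c']innerC [inner x c']innerC.
by move=> h; lra.
Qed.

Context (k : nat).
Context (psi_nN : forall u, (-oo < psi_n u)%E) (psi_n_proper : dom psi_n !=set0)
  (psi_n_convex : convex_efun psi_n) (z0 : Z)
  (iterates : racg_iterates mu M psi_s psi_n z0 z k).

Lemma racg_argmin i : (i < k)%N ->
  argmin (fun u => ((linearization psi_s (zt i) u +
    M / 2 * fnorm (u - zt i) ^+ 2)%:E + psi_n u)%E) (z i.+1).
Proof.
move=> ik; have /= := iterates.2 i ik => zE u.
have : [set z i.+1] (z i.+1) by [].
by rewrite -zE => /(_ u); rewrite !EFinD -!addeA ![(psi_n _ + _)%E]addeC.
Qed.

Lemma racg_iterate_fin_num j : (0 < j <= k)%N -> psi_n (z j) \is a fin_num.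
Proof.
by case: j => // j /= jk; exact: argmin_fin_num (racg_argmin jk).
Qed.

(** [psi_n] is finite at the iterates, so the models take real values; these real versions open the
    way to [lra] and [ring]. *)
Definition racg_gamma_min i : R :=
  linearization psi_s (zt i) (z i.+1) + fine (psi_n (z i.+1)) +
  mu / 2 * fnorm (z i.+1 - zt i) ^+ 2.

Definition racg_gammaR i (u : Z) : R :=
  racg_gamma_min i + ((M - mu) * inner (zt i - z i.+1) (u - z i.+1) +
    mu / 2 * fnorm (u - z i.+1) ^+ 2).

Fixpoint racg_GammaR j (u : Z) : R :=
  if j is i.+1 then
    B i / B i.+1 * racg_GammaR i u + b i / B i.+1 * racg_gammaR i u
  else 0.

Lemma racg_gammaRE i u : (i < k)%N ->
  racg_gamma mu M psi_s psi_n z i u = (racg_gammaR i u)%:E.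
Proof.
move=> ik; rewrite /racg_gamma /racg_gammat -(fineK (@racg_iterate_fin_num i.+1
    _)) //.
Qed.

Lemma racg_GammaRE j u : (j <= k)%N ->
  racg_Gamma mu M psi_s psi_n z j u = (racg_GammaR j u)%:E.
Proof.
elim: j => //= j IH jk.
by rewrite IH ?(ltnW jk) // racg_gammaRE // -!EFinM -EFinD.
Qed.

Lemma racg_BGammaR i u :
  B i.+1 * racg_GammaR i.+1 u = B i * racg_GammaR i u + b i * racg_gammaR i u.
Proof.
have Bi := lt0r_neq0 (racg_BS_gt0 i); rewrite [racg_GammaR _ _]/=.
by rewrite mulrDr; congr (_ + _); rewrite mulrA [B i.+1 * (_ / _)]mulrC divfK.
Qed.

(** The estimate function of accelerated gradient methods. *)
Let phi j u := B j * racg_GammaR j u + 2^-1 * fnorm (u - z 0) ^+ 2.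

(* z^c_j minimizes phi j. *)
Lemma racg_phi_min j u :
  phi j u = phi j (zc j) + (1 + mu * B j) / 2 * fnorm (u - zc j) ^+ 2.
Proof.
elim: j u => [|i IH] u.
  by rewrite /phi /= !mul0r mulr0 subrr fnorm0 !add0r addr0 expr0n mulr0 add0r
      mul1r.
have -> : 1 + mu * B i.+1 = (1 + mu * B i) + b i * mu by rewrite racg_BS; ring.
apply: (@quadratic_min (phi i (zc i) + b i * racg_gamma_min i) _ _ (M - mu) _ (zc
    i) _
  (zt i - z i.+1) (z i.+1)) => [v|].
  rewrite {1}/phi racg_BGammaR -addrA [X in _ + X]addrC addrA -/(phi i v) IH.
  by rewrite /racg_gammaR; ring.
have al0 : 1 + mu * B i + b i * mu != 0.
  rewrite lt0r_neq0 // -addrA ltr_pwDl // addr_ge0 // mulr_ge0 ?racg_B_ge0 //.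
  exact: ltW (racg_b_gt0 i).
rewrite [zc i.+1]/= -/(B i) -/(b i) -/(zt i).
have -> : 1 + mu * (B i + b i) = 1 + mu * B i + b i * mu by ring.
rewrite scalerA divff // scale1r scalerDl scale1r [mu *: (_ + _)]scalerDr !scalerA.
rewrite [mu * b i]mulrC.
by rewrite addrA; congr (_ + _); exact: addrAC.
Qed.

(** [racg_r] is the gradient of Gamma_j at z_j: subtract the expansions of phi j around z^c_j at u
    and at z_j, remove the prox term and divide by B_j. *)
Lemma racg_GammaR_expansion j u : (0 < j)%N ->
  racg_GammaR j u = racg_GammaR j (z j) +
    inner (racg_r mu M z j) (u - z j) + mu / 2 * fnorm (u - z j) ^+ 2.
Proof.
move=> j0; have Bj := racg_B_gt0 j0.
have BV : B j * (B j)^-1 = 1 by rewrite divff // lt0r_neq0.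
apply: (mulfI (lt0r_neq0 Bj)).
have := racg_phi_min j u; have := racg_phi_min j (z j); rewrite /phi.
have -> : B j * (racg_GammaR j (z j) + inner (racg_r mu M z j) (u - z j) +
      mu / 2 * fnorm (u - z j) ^+ 2) =
    B j * racg_GammaR j (z j) + inner (z 0 - zc j) (u - z j) +
    B j * mu * (inner (z j - zc j) (u - z j) + 2^-1 * fnorm (u - z j) ^+ 2).
  rewrite /racg_r [inner (_ + mu *: _) _]innerDl.
  by rewrite !innerZl; field; exact: lt0r_neq0.
rewrite !fnorm2 !innerlin.
rewrite [inner (z j) u]innerC [inner (z 0) u]innerC [inner (zc j) u]innerC.
rewrite [inner (z 0) (z j)]innerC [inner (zc j) (z j)]innerC.
by move=> h1 h2; lra.
Qed.

(** Expanding Gamma_j around z_j cancels every term in z^c_j, so eta_j is the model gap at z_j,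
    truncated at 0. *)
Definition racg_etaR j : R :=
  Num.max 0 (psi_s (z j) + fine (psi_n (z j)) - racg_GammaR j (z j)).

Lemma racg_etaRE j : (0 < j <= k)%N ->
  racg_eta mu M psi_s psi_n z j = (racg_etaR j)%:E.
Proof.
move=> jk; have /andP[j0 jlek] := jk.
rewrite /racg_eta /composite racg_GammaRE // -(fineK (racg_iterate_fin_num jk)).
rewrite /racg_etaR EFin_max -!EFinD; congr (maxe _ _%:E).
rewrite (racg_GammaR_expansion (zc j) j0) /=.
rewrite !fnorm2 !innerlin [inner (zc j) (z j)]innerC.
by ring.
Qed.

Lemma racg_test4_norm theta j : (0 < j <= k)%N ->
  racg_test4 mu M psi_s psi_n theta z j ->
  fnorm (racg_r mu M z j) ^+ 2 + 2 * racg_etaR j <=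
      theta ^+ 2 * fnorm (z j - z0) ^+ 2.
Proof.
move=> jk; rewrite /racg_test4 racg_etaRE // -EFinM -EFinD lee_fin.
by rewrite iterates.1.
Qed.

Section StronglyConvex.
Context
  (lower : forall u y,
    linearization psi_s y u + mu / 2 * fnorm (u - y) ^+ 2 <= psi_s u)
  (upper : forall u y,
    psi_s u <= linearization psi_s y u + M / 2 * fnorm (u - y) ^+ 2).

(** Add the strongly convex minorant of [psi_s] at the extrapolated point to the subgradient of
    [psi_n] that minimality of z_(i+1) provides. *)
Lemma racg_gammaR_le i u : (i < k)%N -> ((racg_gammaR i u)%:E <= psi u)%E.
Proof.
move=> ik; rewrite /composite.
have := argmin_subgradient u psi_nN psi_n_proper psi_n_convex
  (linearization_quadratic psi_s M (zt i)) (racg_argmin ik).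
have fn := @racg_iterate_fin_num i.+1 ik.
rewrite -(fineK fn) => h; apply: le_trans (leeD2l _ h).
rewrite -!EFinD lee_fin /racg_gammaR /racg_gamma_min.
have := lower u (zt i); rewrite /linearization !fnorm2.
move: (fine (psi_n (z i.+1))) => a; move: (grad psi_s (zt i)) => g.
move: (zt i) (z i.+1) => t v; rewrite !innerlin.
by rewrite [inner t u]innerC [inner v u]innerC [inner v t]innerC; lra.
Qed.

Lemma racg_GammaR_le j u : (0 < j <= k)%N -> ((racg_GammaR j u)%:E <= psi u)%E.
Proof.
move=> /andP[j0 jk]; have [->|] := eqVneq (psi u) +oo%E; first exact: leey.
rewrite /composite => psiu.
have gu : psi_n u \is a fin_num.
  rewrite fin_real // psi_nN /= ltey; apply: contra_neq psiu => ->.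
  by rewrite addey.
rewrite -(fineK gu) -EFinD lee_fin.
have gam i : (i < k)%N -> racg_gammaR i u <= psi_s u + fine (psi_n u).
  by move=> ik; have := racg_gammaR_le u ik;
      rewrite /composite -(fineK gu) -EFinD lee_fin.
(* Multiplied by B_j, the induction can start at 0, where B_0 = 0 hides the value of Gamma_0. *)
suff : B j * racg_GammaR j u <= B j * (psi_s u + fine (psi_n u)).
  by rewrite ler_pM2l // racg_B_gt0.
elim: j jk {j0} => [|i IH] ik; first by rewrite !mul0r.
rewrite racg_BGammaR racg_BS mulrDl lerD ?IH ?(ltnW ik) //.
by rewrite ler_pM2l ?racg_b_gt0 // gam.
Qed.

Lemma racg_estimate j : (j <= k)%N ->
  B j * (psi_s (z j) + fine (psi_n (z j))) <= phi j (zc j).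
Proof.
elim: j => [|i IH] ik.
  by rewrite /phi /= !mul0r subrr fnorm0 expr0n mulr0 addr0.
have {}IH := IH (ltnW ik).
have Bi := racg_BS_gt0 i; have bi := racg_b_gt0 i; have Bi0 := racg_B_ge0 i.
have step1 : phi i.+1 (zc i.+1) = phi i (zc i.+1) + b i * racg_gammaR i (zc i.+1).
  by rewrite /phi racg_BGammaR; ring.
rewrite step1 racg_phi_min; set u := zc i.+1.
(* At i = 0 the point z_0 may lie outside the domain of [psi_n], but then B_0 = 0. *)
have prev : B i * racg_gammaR i (z i) <= phi i (zc i).
  have [i0|i0] := posnP i; first by move: IH; rewrite i0 /= !mul0r.
  apply: le_trans IH; rewrite ler_wpM2l //.
  have := racg_gammaR_le (z i) ik; rewrite /composite.
  by rewrite -(fineK (@racg_iterate_fin_num i _)) ?i0 ?(ltnW ik) // -EFinD lee_fin.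
have last : psi_s (z i.+1) + fine (psi_n (z i.+1)) <=
    racg_gamma_min i + (M - mu) / 2 * fnorm (zt i - z i.+1) ^+ 2.
  have := upper (z i.+1) (zt i);
      rewrite /racg_gamma_min -[X in (_ - mu) / 2 * X ^+ 2]fnormN opprB.
  by lra.
suff : B i.+1 * (racg_gamma_min i + (M - mu) / 2 * fnorm (zt i - z i.+1) ^+ 2) <=
    B i * racg_gammaR i (z i) + (1 + mu * B i) / 2 * fnorm (u - zc i) ^+ 2 +
    b i * racg_gammaR i u.
  move=> h; have := ler_wpM2l (ltW Bi) last; lra.
have ztE : B i.+1 *: zt i = B i *: z i + b i *: zc i.
  rewrite /racg_ztilde /racg_mix scalerDr !scalerA ![B i.+1 * _]mulrC !divfK //;
  exact: lt0r_neq0.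
have b2 := racg_b2 i; rewrite /racg_gammaR.
move: (racg_gamma_min i) (zt i) (z i.+1) (z i) (zc i) u ztE => g t v y c u.
move: (B i) (B i.+1) (b i) Bi bi Bi0 b2 (racg_BS i) =>
    B0 B1 b1 B1_gt0 b1_gt0 B0_ge0 b2 B1E tE.
have Mm : 0 < M - mu by rewrite subr_gt0.
pose w := t - v; pose d := u - c.
have combE : B0 *: (y - v) + b1 *: (u - v) = B1 *: w + b1 *: d.
  apply/matrixP => l l'; have := congr1 (fun A : Z => A l l') tE.
  by rewrite B1E !mxE; lra.
have {}combE : B0 * inner w (y - v) + b1 * inner w (u - v) =
    B1 * inner w w + b1 * inner w d.
  by rewrite -!innerZr -!innerDr combE.
have wE : w = t - v by []. have dE : d = u - c by []. clearbody w d.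
(* Multiplied by B1, the left-over terms are (M - mu) / 2 |B1 w + b1 d|^2, because b1^2 (M - mu) =
   (1 + mu B0) B1. This is where the choice of the step pays off. *)
have sq : 0 <= (M - mu) / 2 * (B1 * inner w w + 2 * b1 * inner w d) +
    (1 + mu * B0) / 2 * inner d d.
  rewrite -(pmulr_rge0 _ B1_gt0).
  have := mulr_ge0 (ltW Mm) (inner_ge0 (B1 *: w + b1 *: d)).
  rewrite !innerDl !innerDr !innerZl !innerZr [inner d w]innerC.
  have := congr1 (fun x => x * inner d d) b2; rewrite /=.
  by lra.
have p1 : 0 <= mu / 2 * fnorm (y - v) ^+ 2.
  by rewrite mulr_ge0 ?sqr_ge0 // divr_ge0.
have p2 : 0 <= mu / 2 * fnorm (u - v) ^+ 2.
  by rewrite mulr_ge0 ?sqr_ge0 // divr_ge0.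
have := ler_wpM2l B0_ge0 p1; have := ler_wpM2l (ltW b1_gt0) p2.
rewrite -wE -dE [fnorm w ^+ 2]fnorm2 [fnorm d ^+ 2]fnorm2.
have := congr1 (fun x => (M - mu) * x) combE.
rewrite /= B1E.
move: sq; rewrite B1E.
by lra.
Qed.

Lemma racg_etaR_convex j : (0 < j <= k)%N ->
  racg_etaR j = psi_s (z j) + fine (psi_n (z j)) - racg_GammaR j (z j).
Proof.
move=> jk; rewrite /racg_etaR max_r // subr_ge0.
have := racg_GammaR_le (z j) jk.
by rewrite /composite -(fineK (racg_iterate_fin_num jk)) -EFinD lee_fin.
Qed.

Lemma racg_test3_holds j : (0 < j <= k)%N -> racg_test3 mu M psi_s psi_n z j.
Proof.
move=> jk; have /andP[j0 jlek] := jk.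
rewrite /racg_test3 racg_etaRE // -EFinM -EFinD lee_fin racg_etaR_convex //.
have Bj := racg_B_gt0 j0.
have al : 0 < 1 + mu * B j by rewrite ltr_pwDl // mulr_ge0 // ltW.
(* The first term of the test becomes twice phi j (z_j) - phi j (z^c_j), which [racg_estimate]
   controls. *)
have -> : B j *: racg_r mu M z j + z j - z 0 = (1 + mu * B j) *: (z j - zc j).
  rewrite /racg_r scalerDr !scalerA divff ?lt0r_neq0 // scale1r.
  by apply/matrixP => l l'; rewrite !mxE; ring.
rewrite fnormZ (gtr0_norm al).
have -> : (1 + mu * B j)^-1 * ((1 + mu * B j) * fnorm (z j - zc j)) ^+ 2 =
    (1 + mu * B j) * fnorm (z j - zc j) ^+ 2 by field; exact: lt0r_neq0.
have := racg_estimate jlek; have := racg_phi_min j (z j); rewrite {1}/phi.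
by lra.
Qed.

Lemma racg_subgradient j u : (0 < j <= k)%N ->
  (psi (z j) + (inner (racg_r mu M z j) (u - z j) + mu / 2 * fnorm (u - z j) ^+ 2
     - racg_etaR j)%:E <= psi u)%E.
Proof.
move=> jk; have /andP[j0 jlek] := jk.
apply: le_trans (racg_GammaR_le u jk); rewrite racg_GammaR_expansion //.
rewrite /composite -(fineK (racg_iterate_fin_num jk)) -!EFinD lee_fin.
by rewrite racg_etaR_convex //; lra.
Qed.

Lemma racg_Delta_le j u : (0 < j <= k)%N ->
  (Delta mu psi_s psi_n u (z j) (racg_r mu M z j) <= (racg_etaR j)%:E)%E.
Proof.
move=> jk; have := racg_subgradient u jk; rewrite /Delta.
have psij : psi (z j) \is a fin_num.
  by rewrite /composite -(fineK (racg_iterate_fin_num jk)) -EFinD.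
rewrite -(fineK psij); case: (psi u) => [a|_|] //; last exact: leNye.
rewrite -!EFinD !lee_fin -[z j - u]opprB innerNr.
by lra.
Qed.

(** With D = |z_j - z_0|, step 3 gives B^2 |r|^2 <= (4 + 2 mu B) D^2 and 2 B^2 eta <= B D^2. For B
    >= 1 the sum is at most (5 + 2 mu) B D^2. *)
Lemma racg_test4_eventually theta j : 0 < theta -> (0 < j <= k)%N ->
  1 <= B j -> (5 + 2 * mu) / theta ^+ 2 <= B j ->
  racg_test4 mu M psi_s psi_n theta z j.
Proof.
move=> theta0 jk Bj1; rewrite ler_pdivrMr ?exprn_gt0 // => Bjtheta.
have := racg_test3_holds jk; rewrite /racg_test3 /racg_test4 racg_etaRE //.
rewrite -!EFinM -!EFinD !lee_fin.
set D := fnorm (z j - z 0); set r := racg_r mu M z j.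
have eta0 : 0 <= racg_etaR j by rewrite /racg_etaR le_max lexx.
move: (racg_etaR j) eta0 => eta eta0.
have Bj : 0 < B j by lra.
have al : 0 < 1 + mu * B j by rewrite ltr_pwDl // mulr_ge0 // ltW.
move=> test3.
have n0 : 0 <= (1 + mu * B j)^-1 * fnorm (B j *: r + z j - z 0) ^+ 2.
  by rewrite mulr_ge0 ?sqr_ge0 // invr_ge0 ltW.
have Beta : 2 * B j * eta <= D ^+ 2 by lra.
have Br : fnorm (B j *: r + z j - z 0) ^+ 2 <= (1 + mu * B j) * D ^+ 2.
  rewrite -ler_pdivrMl //; apply: le_trans test3.
  by rewrite lerDl mulr_ge0 // mulr_ge0 // ltW.
have Br2 : B j ^+ 2 * fnorm r ^+ 2 <= (4 + 2 * mu * B j) * D ^+ 2.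
  rewrite -exprMn -[B j]gtr0_norm // -fnormZ gtr0_norm //.
  have -> : B j *: r = (B j *: r + z j - z 0) - (z j - z 0).
    by rewrite opprB addrA subrK addrK.
  move: Br; rewrite /D; move: (B j *: r + z j - z 0) (z j - z 0) => e d.
  have := inner_ge0 (e + d).
  by rewrite !fnorm2 !innerlin [inner d e]innerC; lra.
have D0 : 0 <= D ^+ 2 by exact: sqr_ge0.
have B2 : 0 < B j ^+ 2 by rewrite exprn_gt0.
rewrite -(ler_pM2l B2) mulrDr.
have h1 := ler_wpM2r D0 (ler_wpM2l (ltW Bj) Bjtheta).
have h2 := ler_wpM2l (ltW Bj) Beta.
have h3 := ler_wpM2r D0 Bj1.
by lra.
Qed.

End StronglyConvex.

End RACGAnalysis.

Section RACGOutput.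
Context {R : realType} {p q : nat}.
Context (mu M theta : R) (psi_s : 'M[R]_(p, q) -> R) (psi_n : 'M[R]_(p, q) ->
    \bar R).
Context (mu_ge0 : 0 <= mu) (mu_lt_M : mu < M)
  (psi_nN : forall u, (-oo < psi_n u)%E) (psi_n_proper : dom psi_n !=set0)
  (psi_n_convex : convex_efun psi_n) (z0 : 'M[R]_(p, q)).

Lemma racg_output_bound y v eps :
  racg_output mu M psi_s psi_n theta z0 y v eps ->
  [/\ psi_n y \is a fin_num, 0 <= eps &
      fnorm v ^+ 2 + 2 * eps <= theta ^+ 2 * fnorm (y - z0) ^+ 2].
Proof.
move=> [k [z [[k0 it] _ [_ t4] [-> -> epsE] _]]].
have kk : (0 < k <= k)%N by rewrite k0 leqnn.
move: epsE; rewrite (racg_etaRE _ _ _ _ it) // => -[->]; split.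
- exact: racg_iterate_fin_num it _ kk.
- by rewrite /racg_etaR le_max lexx.
- exact: racg_test4_norm it _ _ kk t4.
Qed.

Lemma racg_output_subgradient y v eps :
  (forall u w, linearization psi_s w u + mu / 2 * fnorm (u - w) ^+ 2 <= psi_s u) ->
  racg_output mu M psi_s psi_n theta z0 y v eps ->
  forall u, (composite psi_s psi_n y +
    (inner v (u - y) + mu / 2 * fnorm (u - y) ^+ 2 - eps)%:E <=
    composite psi_s psi_n u)%E.
Proof.
move=> lower [k [z [[k0 it] _ _ [-> -> epsE] _]]] u.
have kk : (0 < k <= k)%N by rewrite k0 leqnn.
move: epsE; rewrite (racg_etaRE _ _ _ _ it) // => -[->].
exact: racg_subgradient it _ _ _ kk.
Qed.

End RACGOutput.

(** * Existence of the iterates and termination *)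

Section RACGSuccess.
Context {R : realType} {n : nat}.
Local Notation Z := 'rV[R]_n.

Lemma exists_racg_iterates (mu M : R) (psi_s : Z -> R) (psi_n : Z ->
    \bar R) (z0 : Z) :
  0 < M -> proper_lsc_convex psi_n ->
  exists z, forall k, racg_iterates mu M psi_s psi_n z0 z k.
Proof.
move=> M0 psi_n_plc.
have /choice[A AE] : forall y : Z, exists x, argmin (fun u =>
    (linearization psi_s y u)%:E + psi_n u + (M / 2 * fnorm (u - y) ^+ 2)%:E)%E =
        [set x].
  move=> y; have [x xE] := exists_argmin psi_n_plc M0 (linearization_quadratic
      psi_s M y).
  exists x; rewrite -xE; congr argmin; apply/funext => u.
  by rewrite (EFinD (linearization psi_s y u)) addeAC.
(* z^c is defined from the whole sequence z, so the recursion carries the pair (z_i, z^c_i). A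
   constant sequence can be passed to [racg_mix], which reads its sequence at one index only. *)
pose state := fix state i : Z * Z := if i is i'.+1 then
    let x := (state i').1 in let c := (state i').2 in
    let x' := A (racg_mix mu M (fun=> x) i' c) in
    (x', (1 + mu * racg_B mu M i'.+1)^-1 *:
      (c - (racg_b mu M i' * (M - mu)) *: (racg_mix mu M (fun=> x) i' c - x')
       + mu *: (racg_B mu M i' *: c + racg_b mu M i' *: x')))
  else (z0, z0).
exists (fun i => (state i).1) => k; split=> // i _.
have zcE j : racg_zc mu M (fun i => (state i).1) j = (state j).2.
  by elim: j => //= j ->.
by rewrite /racg_ztilde zcE AE.
Qed.

Lemma racg_succeeds (mu M theta : R) (psi_s : Z -> R) (psi_n : Z ->
    \bar R) (z0 : Z) :
  0 <= mu -> mu < M -> 0 < theta -> proper_lsc_convex psi_n ->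
  (forall u w, linearization psi_s w u + mu / 2 * fnorm (u - w) ^+ 2 <= psi_s u) ->
  (forall u w, psi_s u <= linearization psi_s w u + M / 2 * fnorm (u - w) ^+ 2) ->
  exists y v eps, racg_output mu M psi_s psi_n theta z0 y v eps.
Proof.
move=> mu0 muM theta0 psi_n_plc lower upper.
have M0 : 0 < M by exact: le_lt_trans muM.
have [psi_nN psi_n_proper _ psi_n_convex] := psi_n_plc.
have [z it] := exists_racg_iterates mu psi_s z0 M0 psi_n_plc.
pose P j := (0 < j)%N && `[< racg_test4 mu M psi_s psi_n theta z j >].
have exP : exists j, P j.
  pose C := Num.max 1 ((5 + 2 * mu) / theta ^+ 2).
  (* This index exceeds C (M - mu), and B_j >= j / (M - mu). *)
  exists (Num.truncn (C * (M - mu))).+1; apply/andP; split=> //; apply/asboolP.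
  set j := (Num.truncn _).+1.
  have Cj : C <= racg_B mu M j.
    apply: le_trans (racg_B_linear mu0 muM j); rewrite ler_pdivlMr ?subr_gt0 //.
    by rewrite ltW // truncnS_gt.
  apply: (racg_test4_eventually mu0 muM psi_nN psi_n_proper psi_n_convex (it j)
      lower upper) => //.
    by rewrite leqnn.
    by apply: le_trans Cj; rewrite le_max lexx.
  by apply: le_trans Cj; rewrite le_max lexx orbT.
case: (ex_minnP exP) => k /andP[k0 /asboolP t4] kmin.
have kk : (0 < k <= k)%N by rewrite k0 leqnn.
pose v := racg_r mu M z k.
have [yr yrE] := exists_argmin psi_n_plc M0
  (quadratic_proximal M (grad psi_s (z k) - v) (z k)).
exists (z k), v, (racg_etaR mu M psi_s psi_n z k), k, z; split=> //.
- move=> j jk.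
  exact: (racg_test3_holds mu0 muM psi_nN psi_n_proper psi_n_convex (it k) lower
      upper).
- split=> // j /andP[j0 jk] t4j.
  by have := kmin j; rewrite /P j0 /= leqNgt jk => /(_ (introT (asboolP _) t4j)).
- split=> //; rewrite (racg_etaRE mu0 muM psi_nN psi_n_proper (it k)) //.
exists yr, (v + M *: (z k - yr) + grad psi_s yr - grad psi_s (z k)); split=> //.
by apply: (racg_Delta_le mu0 muM psi_nN psi_n_proper psi_n_convex (it k)).
Qed.

End RACGSuccess.

(** * Lifting to matrices *)

Section Lift.
Context {R : realType} {m n : nat}.
Context (P : 'M[R]_m) (Q : 'M[R]_n) (Po : orthogonal_mx P) (Qo : orthogonal_mx Q).
Local Notation r := (minn m n).
Local Notation sigma := (@singular_values R m n).
Implicit Types (a b s y : 'rV[R]_r).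

Definition svd_lift a : 'M[R]_(m, n) := P *m dg a *m Q^T.

Lemma svd_lift_linear : linear svd_lift.
Proof.
move=> k a b; rewrite /svd_lift linearD linearZ /= mulmxDr mulmxDl.
by rewrite -scalemxAr -scalemxAl.
Qed.
HB.instance Definition _ := GRing.isLinear.Build R _ _ _ svd_lift svd_lift_linear.

Lemma inner_svd_lift a b : inner (svd_lift a) (svd_lift b) = inner a b.
Proof. by rewrite inner_orthogonal // inner_dg. Qed.

Lemma fnorm_svd_lift a : fnorm (svd_lift a) = fnorm a.
Proof. by rewrite /fnorm inner_svd_lift. Qed.

Lemma spectral_svd_lift T (f : 'rV[R]_r -> T) a :
  absolutely_symmetric f -> f (sigma (svd_lift a)) = f a.
Proof.
move=> fsym; have [s [e ->]] := singular_values_dg a Po Qo.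
exact: absolutely_symmetric_signed_perm.
Qed.

(** [c] stands for g(y) in the optimality condition of RP and for g(y) - eps in Problem A. *)
Lemma spectral_subgradient (g : 'rV[R]_r -> \bar R) (c : \bar R) y s :
  absolutely_symmetric g ->
  (forall u, c + (inner s (u - y))%:E <= g u)%E ->
  forall U, (c + (inner (svd_lift s) (U - svd_lift y))%:E <= g (sigma U))%E.
Proof.
move=> gsym gsub U; have [p [e le_su]] := von_neumann_signed_perm s U Po Qo.
rewrite -(absolutely_symmetric_signed_perm p e _ gsym).
apply: le_trans (gsub _); rewrite leeD2l // lee_fin !innerDr !innerNr.
by rewrite inner_svd_lift lerD2r.
Qed.

Lemma svd_lift_distance y (Z0 : 'M[R]_(m, n)) :
  fnorm (y - Dg (P^T *m Z0 *m Q)) <= fnorm (svd_lift y - Z0).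
Proof.
have -> : svd_lift y - Z0 = P *m (dg y - P^T *m Z0 *m Q) *m Q^T.
  rewrite mulmxBr mulmxBl !mulmxA Po mul1mx -[X in _ = _ - X]mulmxA Qo mulmx1.
  by [].
rewrite fnorm_orthogonal // -{1}(dgK y) -linearB; exact: fnorm_Dg.
Qed.

End Lift.

Section ConvexGradient.
Context {R : realType}.

Lemma convex_gradient_le p q (f : 'M[R]_(p, q) -> R) x g u :
  has_gradient f x g ->
  (forall t, 0 < t < 1 -> f (t *: u + (1 - t) *: x) <= t * f u + (1 - t) * f x) ->
  f x + inner g (u - x) <= f u.
Proof.
move=> fg fconv; rewrite leNgt; apply/negP => gap.
pose D := fnorm (u - x) + 1.
have D0 : 0 < D by rewrite ltr_wpDl ?fnorm_ge0.
(* A tolerance e with e |u - x| below half of the supposed gap, so that the first-order error at a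
   small t cannot compensate for it. *)
pose e := (f x + inner g (u - x) - f u) / (2 * D).
have e0 : 0 < e by rewrite divr_gt0 ?subr_gt0 ?mulr_gt0.
have [d d0 fd] := fg e e0.
pose t := Num.min (2^-1) (d / (2 * D)).
have t0 : 0 < t by rewrite lt_min invr_gt0 ltr0n divr_gt0 ?mulr_gt0.
have t1 : t < 1 by rewrite gt_min; apply/orP; left; lra.
have tD : t * (2 * D) <= d by rewrite -ler_pdivlMr ?mulr_gt0 // ge_min lexx orbT.
have := fd (t *: u + (1 - t) *: x); have := fconv t; rewrite t0 t1 => /(_ isT).
have -> : t *: u + (1 - t) *: x - x = t *: (u - x).
  by rewrite scalerBl scale1r scalerBr addrA addrAC addrK.
rewrite fnormZ innerZr gtr0_norm //.
have tn : t * fnorm (u - x) < d.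
  by move: tD; rewrite /D; have := mulr_ge0 (ltW t0) (fnorm_ge0 (u - x)); lra.
move=> fle /(_ tn); rewrite ler_norml => /andP[+ _].
have eD : e * (2 * D) = f x + inner g (u - x) - f u.
  by rewrite /e divfK // lt0r_neq0 // mulr_gt0.
move: eD; rewrite /D => eD h.
have := mulr_gt0 t0 (mulr_gt0 e0 D0); rewrite /D.
have := congr1 (fun x => t * x) eD; rewrite /=.
have := fnorm_ge0 (u - x).
by nra.
Qed.

(** With L the lift of vectors to matrices, convexity of f2V o sigma descends to f2V. *)
Lemma convex_function_linear (V1 V2 : lmodType R) (F : V1 -> R)
    (L : {linear V2 -> V1}) (f : V2 -> R) :
  (forall a, F (L a) = f a) -> convex_function (E := V1) setT F ->
  forall u w t, 0 < t < 1 -> f (t *: u + (1 - t) *: w) <= t * f u + (1 - t) * f w.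
Proof.
move=> FE Fconv u w t /andP[t0 t1].
have := Fconv (Itv01 (ltW t0) (ltW t1)) (L u) (L w).
rewrite !in_setT convRE !FE => /(_ isT isT).
by rewrite -!FE linearD !linearZ.
Qed.

Lemma proper_lsc_convexZ p q (h : 'M[R]_(p, q) -> \bar R) (l : R) :
  0 < l -> proper_lsc_convex h -> proper_lsc_convex (fun u => l%:E * h u)%E.
Proof.
move=> l0 [hN [u0 hu0] hlsc hconv]; split.
- move=> u; case: (h u) (hN u) => [a _| _|//]; first by rewrite -EFinM ltNyr.
  by rewrite gt0_muley ?lte_fin.
- exists u0; move: hu0; rewrite /dom /=; case: (h u0) (hN u0) => // a _ _.
  by rewrite -EFinM ltry.
- move=> x a; case hx : (h x) (hN x) => [b| |] // _.
    rewrite -EFinM lte_fin => ab.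
    have [|V Vx hV] := hlsc x (a / l);
        first by rewrite hx lte_fin ltr_pdivrMr // mulrC.
    exists V => // y /hV; case: (h y) => // [c|_];
        last by rewrite gt0_muley ?lte_fin ?ltry.
    by rewrite -EFinM !lte_fin ltr_pdivrMr // mulrC.
  move=> _; have [|V Vx hV] := hlsc x (a / l); first by rewrite hx ltry.
  exists V => // y /hV; case: (h y) => // [c|_];
      last by rewrite gt0_muley ?lte_fin ?ltry.
  by rewrite -EFinM !lte_fin ltr_pdivrMr // mulrC.
- move=> x y t /andP[t0 t1].
  have N a v : 0 <= a -> (a%:E * h v != -oo)%E.
    case: (h v) (hN v) => // _; rewrite le_eqVlt => /orP[/eqP <-|a0].
      by rewrite mul0e.
    by rewrite gt0_muley ?lte_fin.
  rewrite [X in (_ <= X + _)%E]muleCA [X in (_ <= _ + X)%E]muleCA -muleDr //.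
    by rewrite lee_pmul2l ?lte_fin // hconv // t0.
  by rewrite /adde_def !(negPf (N _ _ _)) ?andbF // subr_ge0.
Qed.

End ConvexGradient.

(** * Transfer of Problems A and B from vectors to matrices *)

Section SpectralComposite.
Context {R : realType} {m n : nat}.
Local Notation r := (minn m n).
Local Notation sigma := (@singular_values R m n).
Context (f1 : 'M[R]_(m, n) -> R) (f2V : 'rV[R]_r -> R) (hV : 'rV[R]_r -> \bar R)
  (lambda : R) (Z0 : 'M[R]_(m, n)).
Context (f2sym : absolutely_symmetric f2V) (hsym : absolutely_symmetric hV)
  (df2 : forall x, differentiable f2V x).
Context (P : 'M[R]_m) (Q : 'M[R]_n) (svdPQ : spectral_racg_svd f1 lambda Z0 P Q).
Local Notation W := (shifted_point f1 lambda Z0).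
Local Notation L := (svd_lift P Q).
Local Notation psi_v := (psi_sV f1 f2V lambda Z0).
Local Notation psi_nv := (fun u => (lambda%:E * hV u)%E).

Definition spectral_psi_s (U : 'M[R]_(m, n)) : R :=
  lambda * (f1 Z0 + inner (grad f1 Z0) (U - Z0) + f2V (sigma U))
  + 2^-1 * fnorm (U - Z0) ^+ 2.

Definition spectral_psi_n (U : 'M[R]_(m, n)) : \bar R := (lambda%:E * hV (sigma
    U))%E.

Definition spectral_const : R :=
  lambda * (f1 Z0 - inner (grad f1 Z0) Z0) + 2^-1 * fnorm Z0 ^+ 2.

Let Po : orthogonal_mx P. Proof. by case: svdPQ. Qed.
Let Qo : orthogonal_mx Q. Proof. by case: svdPQ. Qed.
Let WE : W = L (sigma W). Proof. by case: svdPQ. Qed.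

(** The linear terms lambda grad f1(Z0) and -Z0 combine into -W, which is why the method decomposes
    W. *)
Lemma spectral_psi_sE U : spectral_psi_s U =
  spectral_const + lambda * f2V (sigma U) + inner (- W) U + 2^-1 * fnorm U ^+ 2.
Proof.
rewrite /spectral_psi_s /spectral_const /shifted_point !fnorm2 !innerlin.
by rewrite [inner U Z0]innerC; field.
Qed.

Lemma psi_vE u : psi_v u =
  0 + lambda * f2V u + inner (- sigma W) u + 2^-1 * fnorm u ^+ 2.
Proof. by rewrite /psi_sV innerNl add0r. Qed.

Lemma grad_psi_v y : grad psi_v y = lambda *: grad f2V y - sigma W + y.
Proof.
apply: has_gradientE; apply: has_gradient_quadratic psi_vE.
exact: differentiable_has_gradient.
Qed.

Lemma grad_spectral_psi_s y : grad spectral_psi_s (L y) = L (grad psi_v y).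
Proof.
rewrite grad_psi_v linearD linearB linearZ /= -WE.
apply: has_gradientE; apply: has_gradient_quadratic spectral_psi_sE.
exact: has_gradient_spectral.
Qed.

Lemma spectral_psi_s_lift y : spectral_psi_s (L y) = spectral_const + psi_v y.
Proof.
rewrite spectral_psi_sE psi_vE (spectral_svd_lift Po Qo) // fnorm_svd_lift //.
by rewrite !innerNl {1}WE inner_svd_lift //; ring.
Qed.

Lemma spectral_psi_n_lift y : spectral_psi_n (L y) = psi_nv y.
Proof. by rewrite /spectral_psi_n (spectral_svd_lift Po Qo). Qed.

Lemma composite_lift y : composite spectral_psi_s spectral_psi_n (L y) =
  (spectral_const%:E + composite psi_v psi_nv y)%E.
Proof. by rewrite /composite spectral_psi_s_lift spectral_psi_n_lift EFinD addeA.
    Qed.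

Lemma psi_nv_symmetric : absolutely_symmetric psi_nv.
Proof. by split=> [s u|e u]; rewrite ?hsym.1 ?hsym.2. Qed.

Section ProblemB.
Context (lambda_gt0 : 0 < lambda) (h_plc : proper_lsc_convex hV).
Context (mu M theta : R) (mu_ge0 : 0 <= mu) (mu_lt_M : mu < M).

Lemma RP_lift y v yr vr : RP M psi_v psi_nv y v yr vr ->
  RP M spectral_psi_s spectral_psi_n (L y) (L v) (L yr)
    (L v + M *: (L y - L yr) + grad spectral_psi_s (L yr) - grad spectral_psi_s
        (L y)).
Proof.
move=> [yrE _]; split=> //.
have [psi_nN psi_n_proper _ psi_n_convex] := proper_lsc_convexZ lambda_gt0 h_plc.
have yr_min : argmin (fun u => ((inner (grad psi_v y - v) u
    + M / 2 * fnorm (u - y) ^+ 2)%:E + psi_nv u)%E) yr by rewrite yrE.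
have yr_fin := argmin_fin_num psi_nN psi_n_proper yr_min.
have M0 : 0 < M by exact: le_lt_trans mu_lt_M.
have quad := quadratic_proximal M (grad psi_v y - v) y.
have sub := spectral_subgradient Po Qo psi_nv_symmetric
  (fun u => argmin_subgradient u psi_nN psi_n_proper psi_n_convex quad yr_min).
apply: (growth_argmin M0).
  by rewrite spectral_psi_n_lift fin_numD yr_fin.
move=> U; have := sub U; rewrite -/(spectral_psi_n U) spectral_psi_n_lift.
rewrite -(fineK yr_fin) => h; apply: le_trans (leeD2l _ h).
rewrite -!EFinD lee_fin grad_spectral_psi_s -linearB /=.
have -> : L (- (grad psi_v y - v - M *: y + M *: yr)) =
    - (L (grad psi_v y - v) - M *: L y + M *: L yr).
  by rewrite linearN linearD linearB !linearZ.
have := quadratic_proximal M (L (grad psi_v y - v)) (L y) (L yr) U.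
by rewrite innerNl => ->; lra.
Qed.

Lemma spectral_solves_B y v eps :
  racg_output mu M psi_v psi_nv theta (Dg (P^T *m Z0 *m Q)) y v eps ->
  solves_problem_B mu M spectral_psi_s spectral_psi_n theta Z0 (L y) (L v) eps.
Proof.
move=> out.
have [psi_nN psi_n_proper _ psi_n_convex] := proper_lsc_convexZ lambda_gt0 h_plc.
have [y_fin eps0 normle] := racg_output_bound mu_ge0 mu_lt_M psi_nN psi_n_proper
    out.
have [k [z [_ _ _ _ [yr [vr [rp Dle]]]]]] := out.
split=> //.
- by rewrite /dom /= composite_lift /composite -(fineK y_fin) -!EFinD ltry.
- apply: le_trans (_ : theta ^+ 2 * fnorm (y - Dg (P^T *m Z0 *m Q)) ^+ 2 <= _).
    by rewrite fnorm_svd_lift.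
  by rewrite ler_wpM2l ?sqr_ge0 // ler_pXn2r ?nnegrE ?fnorm_ge0 //
      svd_lift_distance.
exists (L yr); eexists; split; first exact: (RP_lift rp).
have yr_min : argmin (fun u => ((inner (grad psi_v y - v) u
    + M / 2 * fnorm (u - y) ^+ 2)%:E + psi_nv u)%E) yr by rewrite rp.1.
have yr_fin := argmin_fin_num psi_nN psi_n_proper yr_min.
move: Dle; rewrite /Delta !composite_lift /composite -(fineK y_fin) -(fineK yr_fin).
rewrite -!linearB /= inner_svd_lift // fnorm_svd_lift // -!EFinD !lee_fin.
by lra.
Qed.

Lemma spectral_solves_A y v eps :
  (forall u w, linearization psi_v w u + 1 / 2 * fnorm (u - w) ^+ 2 <= psi_v u) ->
  1 < M ->
  racg_output 1 M psi_v psi_nv theta (Dg (P^T *m Z0 *m Q)) y v eps ->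
  solves_problem_A 1 spectral_psi_s spectral_psi_n theta Z0 (L y) (L v) eps.
Proof.
move=> lower M1 out.
have [psi_nN psi_n_proper _ psi_n_convex] := proper_lsc_convexZ lambda_gt0 h_plc.
have [y_fin eps0 normle] := racg_output_bound ler01 M1 psi_nN psi_n_proper out.
(* Only this part of psi is absolutely symmetric. Removing -<sigma(W), u> adds sigma(W) to v;
   removing |u|^2 / 2 subtracts y, and uses up exactly the term |u - y|^2 / 2 that strong convexity
   with mu = 1 supplies. *)
pose g u := ((lambda * f2V u)%:E + psi_nv u)%E.
have gsym : absolutely_symmetric g.
  by split=> [s u|e u]; rewrite /g ?f2sym.1 ?f2sym.2 ?hsym.1 ?hsym.2.
have gsub u : ((lambda * f2V y + fine (psi_nv y) - eps)%:E +
    (inner (v + sigma W - y) (u - y))%:E <= g u)%E.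
  have := racg_output_subgradient ler01 M1 psi_nN psi_n_proper psi_n_convex lower
      out u.
  rewrite /g /composite -(fineK y_fin) -!EFinD !psi_vE.
  case: (lambda%:E * hV u)%E (psi_nN u) => // [a _|_ _];
      last by rewrite addey // leey.
  rewrite -!EFinD !lee_fin !fnorm2 /= !innerlin [inner y u]innerC.
  by lra.
have subL := spectral_subgradient Po Qo gsym gsub.
split=> //.
- by rewrite /dom /= composite_lift /composite -(fineK y_fin) -!EFinD ltry.
- move=> U; have := subL U; rewrite subrr fnorm0 composite_lift /g.
  rewrite {2}/composite -/(spectral_psi_n U) spectral_psi_sE.
  rewrite /composite -(fineK y_fin) -!EFinD.
  have -> : L (v + sigma W - y) = L v + W - L y by rewrite linearB linearD /= -WE.
  case: (spectral_psi_n U) => // [a|_]; last by rewrite addey // leey.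
  rewrite -!EFinD !lee_fin psi_vE !fnorm2.
  have WY : inner (sigma W) y = inner W (L y) by rewrite [in RHS]WE inner_svd_lift.
  have YY : inner y y = inner (L y) (L y) by rewrite inner_svd_lift.
  move: WY YY; move: (L y) (L v) => Y V.
  rewrite !innerlin => -> ->; rewrite [inner U Y]innerC.
  by lra.
- apply: le_trans (_ : theta ^+ 2 * fnorm (y - Dg (P^T *m Z0 *m Q)) ^+ 2 <= _).
    by rewrite fnorm_svd_lift.
  by rewrite ler_wpM2l ?sqr_ge0 // ler_pXn2r ?nnegrE ?fnorm_ge0 //
      svd_lift_distance.
Qed.

End ProblemB.

Lemma linearization_psi_v u w : psi_v u - linearization psi_v w u =
  lambda * (f2V u - linearization f2V w u) + 2^-1 * fnorm (u - w) ^+ 2.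
Proof.
rewrite /linearization grad_psi_v !psi_vE !fnorm2.
move: (grad f2V w) (sigma W) => g s; rewrite !innerlin [inner w u]innerC.
by field.
Qed.

Lemma convex_spectral_linearization_le :
  convex_function (E := 'M[R]_(m, n)) setT (fun U => f2V (sigma U)) ->
  forall u w, linearization f2V w u <= f2V u.
Proof.
move=> f2conv u w.
apply: convex_gradient_le (differentiable_has_gradient (df2 w)) _ => t.
apply: convex_function_linear f2conv _ _ _ => a.
exact: (spectral_svd_lift Po Qo a f2sym).
Qed.

End SpectralComposite.

Theorem proposition6 (R : realType) (m n : nat)
  (f1 : 'M[R]_(m, n) -> R)
  (f2V : 'rV[R]_(minn m n) -> R)
  (hV : 'rV[R]_(minn m n) -> \bar R)
  (m1 M1 m2 M2 lambda theta : R) (Z0 : 'M[R]_(m, n))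
  (f2 := fun U : 'M[R]_(m, n) => f2V (singular_values U))
  (h := fun U : 'M[R]_(m, n) => hV (singular_values U))
  (M2p := Num.max M2 0)
  (mu := 1 : R) (M := lambda * M2p + 1)
  (psi_s := fun U : 'M[R]_(m, n) =>
     lambda * (f1 Z0 + inner (grad f1 Z0) (U - Z0) + f2 U)
     + 2^-1 * fnorm (U - Z0) ^+ 2)
  (psi_n := fun U : 'M[R]_(m, n) => (lambda%:E * h U)%E) :
  absolutely_symmetric f2V ->
  absolutely_symmetric hV ->
  proper_lsc_convex hV ->
  continuously_differentiable f1 ->
  continuously_differentiable f2V ->
  curvature_bounded_on (dom h) m1 M1 f1 ->
  curvature_bounded_on (dom hV) m2 M2 f2V ->
  lipschitz_grad_on (dom h) (Num.max `|m1| `|M1|) f1 ->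
  lipschitz_grad_on (dom hV) (Num.max `|m2| `|M2|) f2V ->
  (forall u y, f2V u - linearization f2V y u <= M2p / 2 * fnorm (u - y) ^+ 2) ->
  0 < lambda * M2p ->
  0 < lambda ->
  0 < theta ->
  (forall P Q Y V eps,
     spectral_racg_svd f1 lambda Z0 P Q ->
     spectral_racg_output f1 f2V hV lambda M2 theta Z0 P Q Y V eps ->
     solves_problem_B mu M psi_s psi_n theta Z0 Y V eps)
  /\
  (convex_function (E := 'M[R]_(m, n)) setT f2 ->
     (exists P Q, spectral_racg_svd f1 lambda Z0 P Q) /\
     (forall P Q, spectral_racg_svd f1 lambda Z0 P Q ->
        (exists Y V eps,
           spectral_racg_output f1 f2V hV lambda M2 theta Z0 P Q Y V eps) /\
        (forall Y V eps,
           spectral_racg_output f1 f2V hV lambda M2 theta Z0 P Q Y V eps ->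
           solves_problem_A mu psi_s psi_n theta Z0 Y V eps))).
Proof.
move=> f2sym hsym h_plc _ [df2 _] _ _ _ _ f2up lM2 l0 theta0.
have M_gt1 : 1 < M by rewrite /M ltrDr.
split.
  move=> P Q Y V eps svdPQ [y [v [out -> ->]]].
  exact: (spectral_solves_B f2sym hsym df2 svdPQ l0 h_plc ler01 M_gt1 out).
move=> f2conv; split.
  have [P [Q [Po Qo _ WE]]] := exists_svd (shifted_point f1 lambda Z0).
  by exists P, Q.
move=> P Q svdPQ.
(* The term |u|^2 / 2 gives the modulus mu = 1 and convexity of f2V does the rest. *)
have lower u w : linearization (psi_sV f1 f2V lambda Z0) w u
    + 1 / 2 * fnorm (u - w) ^+ 2 <= psi_sV f1 f2V lambda Z0 u.
  rewrite addrC -lerBrDr linearization_psi_v //.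
  have := convex_spectral_linearization_le f2sym df2 svdPQ f2conv u w.
  by move=> f2le; have := ler_wpM2l (ltW l0) f2le; lra.
have upper u w : psi_sV f1 f2V lambda Z0 u <=
    linearization (psi_sV f1 f2V lambda Z0) w u + M / 2 * fnorm (u - w) ^+ 2.
  rewrite -lerBlDl linearization_psi_v // /M.
  have := ler_wpM2l (ltW l0) (f2up u w).
  by lra.
split=> [|Y V eps [y [v [out -> ->]]]].
  have [y [v [eps out]]] := racg_succeeds (Dg (P^T *m Z0 *m Q)) ler01 M_gt1 theta0
    (proper_lsc_convexZ l0 h_plc) lower upper.
  by exists (P *m dg y *m Q^T), (P *m dg v *m Q^T), eps, y, v.
exact: (spectral_solves_A f2sym hsym svdPQ l0 h_plc lower M_gt1 out).
Qed.
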